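(* Consider the planar differential system $$\dot x=P(x,y),\qquad \dot y=Q(x,y),$$ where $P$ and $Q$ are real polynomials of degree $n$ and $P(0,0)=Q(0,0)=0$. Let $$R(r,\theta)=P(r\cos\theta,r\sin\theta)\cos\theta+Q(r\cos\theta,r\sin\theta)\sin\theta,$$ $$\Theta(r,\theta)=\frac1r\big(Q(r\cos\theta,r\sin\theta)\cos\theta-P(r\cos\theta,r\sin\theta)\sin\theta\big),$$ so that the system in polar coordinates is $\dot r=R(r,\theta)$, $\dot\theta=\Theta(r,\theta)$. Define the polynomial $p$ by $$p(r^2):=\frac1{2\pi r}\int_0^{2\pi}R(r,\theta)\,d\theta,$$ and set $w(r)=r^2p'(r^2)$. Denote by $d$ the degree of $w$ and by $N^+$ its number of non-negative roots. For each fixed $s\in\mathbb{R}$ consider the function $$M_s(r,\theta):=R(r,\theta)w'(r)+s\left(\frac{\partial R(r,\theta)}{\partial r}+\frac{\partial\Theta(r,\theta)}{\partial\theta}+\frac{R(r,\theta)}r\right)w(r)=:\sum_{i=1}^{n+d-1}m_i(s,\theta)r^i,$$ and, for any $i\ge1$, let $\mu_i(s)$ be such that $\max_{\theta\in[0,2\pi]}m_i(s,\theta)\le\mu_i(s)$. Then, if the polynomial $$\Phi_s(r):=\sum_{i=1}^{n+d-1}\mu_i(s)r^i$$ is negative for all $r\in(0,\infty)$, the system has at most $N^+$ limit cycles and all of them are hyperbolic.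
   Context: A limit cycle is an isolated periodic orbit; a periodic orbit $(x(t),y(t))$ of period $T$ of $X=(P,Q)$ is hyperbolic if $\int_0^T\operatorname{div}X(x(t),y(t))\,dt\neq0$. Roots of $w$ are counted as distinct real roots. *)

(* Defs.v *)
(* The notations of mpoly are left out: they clash with those of
   MathComp-Analysis. *)
From HB Require Import structures.
From mathcomp Require Import all_boot all_order all_algebra.
From mathcomp Require Import finmap.
From mathcomp Require Import all_classical all_reals all_analysis.
From mathcomp Require Import -(notations) mpoly.

Set Implicit Arguments.
Unset Strict Implicit.
Unset Printing Implicit Defensive.

Import Order.TTheory GRing.Theory Num.Theory.
Import numFieldNormedType.Exports.

Local Open Scope classical_set_scope.
Local Open Scope ring_scope.

Notation bipoly R := (mpoly 2 R).

Section Defs.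
Variable R : realType.
Implicit Types (P Q : bipoly R) (p w : {poly R}) (g : set (R * R)).

Definition eval2 P (x y : R) : R := meval (tnth [tuple x; y]) P.

(* [msize] is the total degree plus one, and 0 for the zero polynomial; the
   degree of the system is the larger of the degrees of its components. *)
Definition system_degree P Q (n : nat) : Prop := maxn (msize P) (msize Q) = n.+1.

Definition divergence P Q : bipoly R :=
  mderiv ord0 P + mderiv ord_max Q.

Definition periodic_solution P Q (x y : R -> R) (T : R) : Prop :=
  [/\ forall t : R, is_derive t (1 : R) x (eval2 P (x t) (y t)),
      forall t : R, is_derive t (1 : R) y (eval2 Q (x t) (y t)),
      0 < T,
      forall t : R, x (t + T) = x t /\ y (t + T) = y t
    & exists t : R, (x t, y t) <> (x 0, y 0)].

Definition orbit_of (x y : R -> R) : set (R * R) :=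
  range (fun t : R => (x t, y t)).

Definition periodic_orbit P Q g : Prop :=
  exists x y T, periodic_solution P Q x y T /\ g = orbit_of x y.

Definition limit_cycle P Q g : Prop :=
  periodic_orbit P Q g /\
  exists U : set (R * R), [/\ open U, g `<=` U &
    forall g', periodic_orbit P Q g' -> g' `<=` U -> g' = g].

(* The period T need not be minimal: over k times the minimal period the
   integral is multiplied by k, so its non-vanishing does not depend on T,
   nor does it depend on the starting point of the parametrization. *)
Definition hyperbolic P Q g : Prop :=
  forall x y T, periodic_solution P Q x y T -> g = orbit_of x y ->
    \int[lebesgue_measure]_(t in `[0, T])
      eval2 (divergence P Q) (x t) (y t) != 0.

Definition polar_R P Q (r th : R) : R :=
  eval2 P (r * cos th) (r * sin th) * cos th +
  eval2 Q (r * cos th) (r * sin th) * sin th.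

Definition polar_Theta P Q (r th : R) : R :=
  r^-1 * (eval2 Q (r * cos th) (r * sin th) * cos th -
          eval2 P (r * cos th) (r * sin th) * sin th).

(* This determines p, since it prescribes p on all positive reals. *)
Definition averaged_poly P Q p : Prop :=
  forall r : R, 0 < r ->
    p.[r ^+ 2] =
    (2 * pi * r)^-1 * \int[lebesgue_measure]_(th in `[0, 2 * pi]) polar_R P Q r th.

Definition w_poly p : {poly R} := 'X^2 * (p^`() \Po 'X^2).

Definition degree w : nat := (size w).-1.

(* Distinct roots; the zero polynomial (infinitely many roots) gets 0. *)
Definition nb_nneg_roots w : nat :=
  #|` fset_set [set r : R | 0 <= r /\ root w r] |%fset.

Definition M_fun P Q w (s r th : R) : R :=
  polar_R P Q r th * w^`().[r] +
  s * (derive1 (fun r' => polar_R P Q r' th) r +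
       derive1 (fun th' => polar_Theta P Q r th') th +
       polar_R P Q r th / r) * w.[r].

(* [m i] is the coefficient of r^i, for 1 <= i <= n + d - 1, in the expansion
   of M_s(r, th) in powers of r; the identity determines these coefficients. *)
Definition M_expansion P Q w (s : R) (N : nat) (m : nat -> R -> R) : Prop :=
  forall r th : R, 0 < r ->
    M_fun P Q w s r th = \sum_(1 <= i < N.+1) m i th * r ^+ i.

Definition Phi_poly (N : nat) (mu : nat -> R) : {poly R} :=
  \sum_(1 <= i < N.+1) mu i *: 'X^i.

End Defs.

(* Main.v *)
(* Put V(x, y) = w(|(x, y)|). The hypothesis says that M = X.V + s V div X < 0 off
   the origin. Hence V exp(s int div X) strictly decreases along a periodic
   orbit: V has no zero on the orbit and the integral of div X over a period is
   nonzero, which is hyperbolicity. Each periodic orbit thus lies in one of the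
   annuli cut out by the circles w = 0, of which there are as many as non-negative
   roots of w (0 is one of them), and it remains to see that an annulus contains
   at most one.

   Given two periodic orbits in the same annulus, a combination of their winding
   number functions that vanishes at the origin is nonzero somewhere; one of its
   nonzero level sets D is open, lies inside the annulus and is locally constant
   off the orbits. On D the divergence of |V|^(1/s) X has constant sign, as it is
   |V|^(1/s) M / (s V). To contradict the divergence theorem without any geometry
   of the boundary, use U(z) = int |z - g(t)|^(-2) dt, summed over the two orbits g:
   it tends to infinity at the orbits while |X.U| <= C U. So the cutoff
   max(0, 1 - k log(1 + U))^2 makes the field compactly supported in D and alters
   its divergence by O(k) only. *)

(* Winding numbers stand in for the Jordan curve theorem: off the curve they are locally constant,
   they jump across it at a regular point, and they vanish far away. A single orbit may enclose the
   origin, and its level set would then contain the hole of the annulus, where V has zeros; two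
   orbits leave room for a nontrivial combination that vanishes on the hole. The boundary of D
   consists of points of the orbits, but nothing is said about which ones, so no flux through it is
   computed. The bound on X.U comes from invariance under time translation: moving z and g(t)
   together along the flow changes the integral over a period by nothing, so only X(z) - X(g(t))
   counts, which is of order |z - g(t)|. The logarithm then makes X.log(1 + U) bounded, and for
   small k the error is beaten by the contribution of one fixed box inside D. *)
Require Import Defs.
From HB Require Import structures.
From mathcomp Require Import all_boot all_order all_algebra.
From mathcomp Require Import finmap.
From mathcomp Require Import all_classical all_reals all_analysis.
From mathcomp Require Import -(notations) mpoly.
From mathcomp Require Import ring lra zify.

Set Implicit Arguments.
Unset Strict Implicit.
Unset Printing Implicit Defensive.

Import Order.TTheory GRing.Theory Num.Theory.
Import numFieldNormedType.Exports.

Local Open Scope classical_set_scope.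
Local Open Scope ring_scope.

(** * Calculus on the line *)

Section Calculus.
Variable R : realType.
Implicit Types (f g F G df : R -> R) (a b c x l m : R).
Local Notation der f t l := (is_derive t (1 : R) f l).

Lemma der_eq f x l l' : der f x l -> l = l' -> der f x l'.
Proof. by move=> ? <-. Qed.

Lemma derD f g x l m : der f x l -> der g x m -> der (fun t => f t + g t) x (l + m).
Proof. exact: is_deriveD. Qed.

Lemma derN f x l : der f x l -> der (fun t => - f t) x (- l).
Proof. exact: is_deriveN. Qed.

Lemma derB f g x l m : der f x l -> der g x m -> der (fun t => f t - g t) x (l - m).
Proof. exact: is_deriveB. Qed.

Lemma derM f g x l m : der f x l -> der g x m ->
  der (fun t => f t * g t) x (l * g x + f x * m).
Proof.
move=> df dg; have /= := is_deriveM df dg.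
by move/der_eq; apply; rewrite /= addrC [g x *: _]mulrC.
Qed.

Lemma derV f x l : f x != 0 -> der f x l ->
  der (fun t => (f t)^-1) x (- l / f x ^+ 2).
Proof.
move=> fx df; apply: der_eq (is_deriveV fx df) _.
by rewrite /GRing.scale /= mulrC mulrN mulNr.
Qed.

Lemma der_comp f g x l m : der f (g x) l -> der g x m ->
  der (fun t => f (g t)) x (l * m).
Proof. exact: is_derive1_comp. Qed.

Lemma der_cst (c x : R) : der (fun=> c) x 0.
Proof. exact: is_derive_cst. Qed.

Lemma der_id (x : R) : der (fun t => t) x 1.
Proof. exact: is_derive_id. Qed.

Lemma derMl (c : R) f x l : der f x l -> der (fun t => c * f t) x (c * l).
Proof. by move=> df; apply: der_eq (derM (der_cst c x) df) _; rewrite mul0r add0r. Qed.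

Lemma der_sqr f x l : der f x l -> der (fun t => f t ^+ 2) x (2 * f x * l).
Proof.
move=> df; apply: der_eq (derM df df) _; ring.
Qed.

Lemma der_continuous f x l : der f x l -> {for x, continuous f}.
Proof. by move=> [df _]; exact/differentiable_continuous/derivable1_diffP. Qed.

Lemma cont_cst (T : topologicalType) (c : R) : continuous (fun _ : T => c).
Proof. by move=> x; exact: cst_continuous. Qed.

Lemma contD (T : topologicalType) (f g : T -> R) :
  continuous f -> continuous g -> continuous (fun y => f y + g y).
Proof. by move=> cf cg y; exact: (@continuousD _ _ _ f g y (cf y) (cg y)). Qed.

Lemma contM (T : topologicalType) (f g : T -> R) :
  continuous f -> continuous g -> continuous (fun y => f y * g y).
Proof. by move=> cf cg y; exact: (@continuousM _ _ f g y (cf y) (cg y)). Qed.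

Lemma contB (T : topologicalType) (f g : T -> R) :
  continuous f -> continuous g -> continuous (fun y => f y - g y).
Proof. by move=> cf cg y; exact: (@continuousB _ _ _ f g y (cf y) (cg y)). Qed.

Lemma contV (T : topologicalType) (f : T -> R) :
  continuous f -> (forall y, f y != 0) -> continuous (fun y => (f y)^-1).
Proof. by move=> cf f0 y; exact: (@continuousV _ _ f y (f0 y) (cf y)). Qed.

Lemma contMl (T : topologicalType) (c : R) (f : T -> R) :
  continuous f -> continuous (fun y => c * f y).
Proof. exact: contM (@cont_cst T c). Qed.

Lemma near_dist (x d : R) : 0 < d -> \forall z \near x, `|z - x| < d.
Proof.
move=> d0; near=> z; rewrite distrC; near: z.
exact: (@cvgr_dist_lt _ _ _ (nbhs x) _ id x _ d d0).
Unshelve. all: by end_near. Qed.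

Lemma near_distP (x : R) (A : R -> Prop) : (\forall z \near x, A z) ->
  exists2 d, 0 < d & forall z, `|z - x| < d -> A z.
Proof.
move=> /nbhs_ballP[d /= d0 H]; exists d => // z zd; apply: H.
by rewrite /ball /= distrC.
Qed.

(** Caratheodory's criterion reduces the estimate to continuity of a slope function, so that users
    of this form never divide by z - x. *)
Lemma derP f x l :
  (forall e, 0 < e -> exists2 d, 0 < d &
     forall z, `|z - x| < d -> `|f z - f x - l * (z - x)| <= e * `|z - x|) ->
  der f x l.
Proof.
move=> H; apply/is_derive1_caratheodory.
exists (fun z => if z == x then l else (f z - f x) / (z - x)); split.
- move=> z; case: eqP => [->|/eqP]; first by rewrite !subrr mulr0.
  by rewrite -subr_eq0 => zx; rewrite divfK.
- apply/cvgrPdist_le => /= e e0; rewrite eqxx.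
  have [d d0 {}H] := H e e0.
  near=> z; case: eqP => [_|/eqP zx]; first by rewrite subrr normr0 ltW.
  have zx0 : 0 < `|z - x| by rewrite normr_gt0 subr_eq0.
  rewrite -(ler_pM2r zx0) -normrM.
  have -> : (l - (f z - f x) / (z - x)) * (z - x) = - (f z - f x - l * (z - x)).
    by rewrite mulrBl divfK ?subr_eq0//; ring.
  by rewrite normrN; apply: H; near: z; exact: near_dist.
- by rewrite eqxx.
Unshelve. all: by end_near. Qed.

Lemma der_MVT f df a b : a <= b -> (forall x, a <= x <= b -> der f x (df x)) ->
  exists2 c, a <= c <= b & f b - f a = df c * (b - a).
Proof.
move=> ab H; have [||c] := @MVT_segment R f df a b ab.
- by move=> x; rewrite in_itv/= => /andP[/ltW ? /ltW ?]; apply: H; apply/andP.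
- by apply: derivable_within_continuous => x; rewrite in_itv/= => /H [].
- by rewrite in_itv /= => ? ?; exists c.
Qed.

Lemma der_ge0 f df a b : a <= b -> (forall x, a <= x <= b -> der f x (df x)) ->
  (forall x, a <= x <= b -> 0 <= df x) -> f a <= f b.
Proof.
move=> ab H H0; have [c cab E] := der_MVT ab H.
by rewrite -subr_ge0 E mulr_ge0 ?H0// subr_ge0.
Qed.

Lemma der_gt0 f df a b : a < b -> (forall x, a <= x <= b -> der f x (df x)) ->
  (forall x, a <= x <= b -> 0 < df x) -> f a < f b.
Proof.
move=> ab H H0; have [c cab E] := der_MVT (ltW ab) H.
by rewrite -subr_gt0 E mulr_gt0 ?H0// subr_gt0.
Qed.

Lemma der_eq_diff f F G a b : a <= b ->
  (forall x, a <= x <= b -> der F x (f x)) ->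
  (forall x, a <= x <= b -> der G x (f x)) -> F b - F a = G b - G a.
Proof.
move=> ab HF HG.
have [|c _] := @der_MVT (fun x => F x - G x) (fun x => f x - f x) _ _ ab.
  by move=> x xab; exact: derB (HF x xab) (HG x xab).
by rewrite subrr mul0r => H; lra.
Qed.

Lemma der_near_eq f g x l : (\forall z \near x, f z = g z) -> der f x l -> der g x l.
Proof. exact: near_eq_is_derive. Qed.

Lemma integral_der f (b : R) : continuous f ->
  exists F, forall x, b < x -> der F x (f x).
Proof.
move=> cf; exists (fun x => \int[lebesgue_measure]_(t in `[b, x]) f t) => x bx.
have [|||| dF <-] := @continuous_FTC1_closed R f b x (x + 1); first by rewrite ltrDl.
- apply: continuous_compact_integrable; first exact: segment_compact.
  exact: continuous_subspaceT.
- exact: bx.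
- exact: cf.
- rewrite derive1E; exact: derivableP.
Qed.

Lemma prim_ex f : continuous f -> exists F, forall x, der F x (f x).
Proof.
move=> cf; have /choice[G dG] b := integral_der b cf.
(* Each [G b] is a primitive only to the right of b. Its differences do not depend on b, so the base
   point may move with x as long as it stays below both 0 and x. *)
pose F x := G (- `|x| - 1) x - G (- `|x| - 1) 0.
exists F => x0; pose a := - `|x0| - 2.
have FE x : `|x - x0| < 1 -> F x = G a x - G a 0.
  move=> xx0.
  have := ler_normD (x - x0) x0; rewrite subrK => nx.
  have la : a < - `|x| by rewrite /a; lra.
  have [x_ge0|x_lt0] := leP 0 x.
    apply: (@der_eq_diff f) => // y /andP[y0 _]; apply: dG; last first.
      have := normr_ge0 x0; rewrite /a; lra.
    have := normr_ge0 x; lra.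
  rewrite -[LHS]opprB -[RHS]opprB; congr (- _).
  apply: (@der_eq_diff f) => //; first exact: ltW.
    move=> y /andP[xy _]; apply: dG; move: xy; rewrite ltr0_norm//; lra.
  move=> y /andP[xy _]; apply: dG; move: la xy; rewrite ltr0_norm//; lra.
apply: (@der_near_eq (fun x => G a x - G a 0)).
  by near=> x; rewrite FE//; near: x; exact: near_dist.
apply: der_eq (derB (dG a x0 _) (der_cst _ _)) _; last by rewrite subr0.
by rewrite /a; have := ler_norm (- x0); rewrite normrN; lra.
Unshelve. all: by end_near. Qed.

(* Choosing primitives on the whole line makes every integral of a continuous
   function a difference of two values, and the facts needed about integrals
   consequences of the mean value theorem. *)
Definition prim f : R -> R := xget (fun=> 0) [set F | forall x, der F x (f x)].

Lemma primP f x : continuous f -> der (prim f) x (f x).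
Proof. by move=> /prim_ex[F HF]; rewrite /prim; case: xgetP => [G _|/(_ F)//]. Qed.

Definition Int f a b : R := prim f b - prim f a.

Lemma IntE f G a b : a <= b -> continuous f ->
  (forall x, a <= x <= b -> der G x (f x)) -> Int f a b = G b - G a.
Proof. by move=> ab cf; apply: der_eq_diff => // x _; exact: primP. Qed.

Lemma Int_cat f a b c : Int f a b + Int f b c = Int f a c.
Proof. rewrite /Int; ring. Qed.

Lemma Int_le f g a b : a <= b -> continuous f -> continuous g ->
  (forall x, a <= x <= b -> f x <= g x) -> Int f a b <= Int g a b.
Proof.
move=> ab cf cg fg; have := @der_ge0 (fun x => prim g x - prim f x) _ a b ab.
move=> /(_ (fun x => g x - f x)) H.
rewrite -subr_ge0; have : prim g a - prim f a <= prim g b - prim f b.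
  apply: H => [x _|x /fg]; first by apply: derB; exact: primP.
  by rewrite subr_ge0.
by rewrite /Int; lra.
Qed.

Lemma IntD f g a b : a <= b -> continuous f -> continuous g ->
  Int (fun x => f x + g x) a b = Int f a b + Int g a b.
Proof.
move=> ab cf cg.
have c := contD cf cg.
have H x : a <= x <= b -> der (fun x => prim f x + prim g x) x (f x + g x).
  by move=> _; apply: derD; exact: primP.
rewrite (IntE ab c H) /Int; ring.
Qed.

Lemma IntZ (k : R) f a b : a <= b -> continuous f ->
  Int (fun x => k * f x) a b = k * Int f a b.
Proof.
move=> ab cf.
have c := contMl (c := k) cf.
have H x : a <= x <= b -> der (fun x => k * prim f x) x (k * f x).
  by move=> _; apply: derMl; exact: primP.
rewrite (IntE ab c H) /Int; ring.
Qed.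

Lemma Int_cst (k : R) a b : a <= b -> Int (fun=> k) a b = k * (b - a).
Proof.
move=> ab; have c := cont_cst (T := R) (c := k).
have H x : a <= x <= b -> der (fun x => k * x) x k.
  by move=> _; apply: der_eq (derMl k (der_id x)) _; rewrite mulr1.
rewrite (IntE ab c H); ring.
Qed.

Lemma Int_norm_le f (k : R) a b : a <= b -> continuous f ->
  (forall x, a <= x <= b -> `|f x| <= k) -> `|Int f a b| <= k * (b - a).
Proof.
move=> ab cf H; rewrite ler_norml -mulNr -!Int_cst//.
by rewrite !Int_le//; try exact: cont_cst; move=> x /H; rewrite ler_norml => /andP[].
Qed.

End Calculus.

(** * Parameter integrals, the divergence theorem on a square, and the argument *)

Section Param.
Variable R : realType.
Implicit Types (f g F G df : R -> R) (a b c x l m t e : R).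
Local Notation der f t l := (is_derive t (1 : R) f l).

(** Uniformity in t is compactness of the segment. Near each t both [H z t'] and [H z0 t'] are
    compared with [H z0 t], hence the halves of e. *)
Lemma segment_near (Z : topologicalType) (H : Z -> R -> R) (z0 : Z) a b e :
  (forall t, a <= t <= b -> {for (z0, t), continuous (fun p => H p.1 p.2)}) ->
  0 < e -> \forall z \near z0, forall t, a <= t <= b -> `|H z t - H z0 t| <= e.
Proof.
move=> cH e0.
have := @segment_compact _ a b; rewrite compact_near_coveringP.
move=> /(_ Z (nbhs z0) (fun z t => `|H z t - H z0 t| <= e)).
have P t : [set` `[a, b]] t ->
   \forall t' \near t & z \near z0, `|H z t' - H z0 t'| <= e.
  rewrite /= in_itv/= => tab.
  have e20 : 0 < e / 2 by rewrite divr_gt0.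
  have /cvgrPdist_le/(_ _ e20) := cH t tab.
  move=> [[A B] /= [A0 Bt] AB].
  exists (B, A) => //= -[t' z] /= [Bt' Az].
  have /= := AB (z, t') (conj Az Bt').
  have /= := AB (z0, t') (conj (nbhs_singleton A0) Bt').
  have -> : H z t' - H z0 t' = (H z0 t - H z0 t') - (H z0 t - H z t') by ring.
  move=> h1 h2; apply: le_trans (ler_normB _ _) _; lra.
move=> /(_ _ P); apply: filterS => z + t tab; apply.
by rewrite /= in_itv.
Qed.

Lemma Int_param_continuous (Z : topologicalType) (H : Z -> R -> R) (z0 : Z) a b :
  a <= b -> (\forall z \near z0, continuous (H z)) ->
  (forall t, a <= t <= b -> {for (z0, t), continuous (fun p => H p.1 p.2)}) ->
  {for z0, continuous (fun z => Int (H z) a b)}.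
Proof.
move=> ab cz cH; apply/cvgrPdist_le => /= e e0.
(* The summand 1 covers the degenerate segment a = b. *)
pose e' := e / (b - a + 1).
have ba : 0 < b - a + 1 by lra.
have e'0 : 0 < e' by rewrite divr_gt0.
have near_le := segment_near cH e'0.
have c0 := nbhs_singleton cz.
near=> z.
have cHz : continuous (H z) by near: z.
have c1 : continuous (fun t => -1 * H z0 t).
  exact: contMl.
have -> : Int (H z0) a b - Int (H z) a b = - Int (fun t => H z t + -1 * H z0 t) a b.
  by rewrite IntD ?IntZ//; ring.
rewrite normrN; apply: (@le_trans _ _ (e' * (b - a))).
  apply: Int_norm_le => //.
    exact: contD.
  by move=> t tab; rewrite mulN1r; move: t tab; near: z.
rewrite /e' mulrAC ler_pdivrMr// ler_pM2l//; lra.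
Unshelve. all: by end_near. Qed.

(** The mean value theorem in the parameter turns the increment of [H] into a value of [dH] at an
    intermediate point, which [segment_near] makes close to [dH x0] uniformly in t. *)
Lemma Int_param_der (H dH : R -> R -> R) x0 a b : a <= b ->
  (\forall x \near x0, continuous (H x) /\
     forall t, a <= t <= b -> der (fun z => H z t) x (dH x t)) ->
  continuous (dH x0) ->
  (forall t, a <= t <= b -> {for (x0, t), continuous (fun p : R * R => dH p.1 p.2)}) ->
  der (fun x => Int (H x) a b) x0 (Int (dH x0) a b).
Proof.
move=> ab nH cdH cH; apply: derP => e e0.
pose e' := e / (b - a + 1).
have ba : 0 < b - a + 1 by lra.
have e'0 : 0 < e' by rewrite divr_gt0.
have [d1 d10 H1] := near_distP nH.
have [d2 d20 H2] := near_distP (segment_near cH e'0).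
exists (Num.min d1 d2); first by rewrite lt_min d10.
move=> z; rewrite lt_min => /andP[zd1 zd2].
have [cHz _] := H1 z zd1.
have [cH0 _] : continuous (H x0) /\ True by split => //; apply H1; rewrite subrr normr0.
have -> : Int (H z) a b - Int (H x0) a b - Int (dH x0) a b * (z - x0)
    = Int (fun t => H z t + (-1 * H x0 t + - (z - x0) * dH x0 t)) a b.
  have c1 : continuous (fun t => -1 * H x0 t).
    exact: contMl.
  have c2 : continuous (fun t => - (z - x0) * dH x0 t).
    exact: contMl.
  by rewrite !IntD ?IntZ//; [ring|exact: contD].
apply: (@le_trans _ _ (e' * `|z - x0| * (b - a))).
  apply: Int_norm_le => //.
    by apply: contD => //; apply: contD; exact: contMl.
  move=> t tab.
  have -> : H z t + (-1 * H x0 t + - (z - x0) * dH x0 t)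
    = H z t - H x0 t - dH x0 t * (z - x0) by ring.
  have [x0z|/ltW zx0] := leP x0 z.
    have [y yz|c /andP[c1 c2] ->] :=
      @der_MVT R (fun z => H z t) (fun x => dH x t) _ _ x0z.
      apply H1 => //; move: zd1 yz => /[swap] /andP[? ?].
      by rewrite !ger0_norm//; lra.
    rewrite -mulrBl normrM ler_wpM2r//; apply: H2 => //.
    by move: zd2; rewrite !ger0_norm//; lra.
  have [y yz|c /andP[c1 c2] E] :=
    @der_MVT R (fun z => H z t) (fun x => dH x t) _ _ zx0.
    apply H1 => //; move: zd1 yz => /[swap] /andP[? ?].
    by rewrite !ler0_norm//; lra.
  have -> : H z t - H x0 t = dH c t * (z - x0) by rewrite -[LHS]opprB E; ring.
  rewrite -mulrBl normrM ler_wpM2r//; apply: H2 => //.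
  by move: zd2; rewrite !ler0_norm//; lra.
rewrite mulrAC ler_wpM2r// /e' mulrAC ler_pdivrMr// ler_pM2l//; lra.
Qed.

(** Applied once in each variable to bound an iterated integral from below: a gain c on a
    subinterval against a loss of at most e everywhere. *)
Lemma Int_lower f a p q b c e : a <= p -> p <= q -> q <= b -> continuous f ->
  (forall x, a <= x <= b -> - e <= f x) ->
  (forall x, p <= x <= q -> c - e <= f x) ->
  c * (q - p) - e * (b - a) <= Int f a b.
Proof.
move=> ap pq qb cf H1 H2; rewrite -(Int_cat f a p b) -(Int_cat f p q b).
have cc (k : R) := cont_cst (T := R) (c := k).
have : Int (fun=> - e) a p <= Int f a p.
  by apply: Int_le => // x /andP[x1 x2]; apply: H1; lra.
have : Int (fun=> c - e) p q <= Int f p q by exact: Int_le.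
have : Int (fun=> - e) q b <= Int f q b.
  by apply: Int_le => // x /andP[x1 x2]; apply: H1; lra.
by rewrite !Int_cst//; lra.
Qed.

(* The iterated integral of [G1 + G2] over the square [[-K, K]^2] vanishes, as
   [G1 + G2] is the divergence of a field that is zero on the boundary. *)
Lemma divergence_lower (F1 F2 G1 G2 : R -> R -> R) (K r x0 y0 : R) c e :
  (forall x y, der (fun x' => F1 x' y) x (G1 x y)) ->
  (forall x y, der (fun y' => F2 x y') y (G2 x y)) ->
  (forall x, continuous (F1 x)) ->
  continuous (fun p : R * R => G1 p.1 p.2) ->
  continuous (fun p : R * R => G2 p.1 p.2) ->
  (forall y, F1 (- K) y = 0 /\ F1 K y = 0) ->
  (forall x, F2 x (- K) = 0 /\ F2 x K = 0) ->
  0 <= r -> - K <= x0 - r -> x0 + r <= K -> - K <= y0 - r -> y0 + r <= K ->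
  (forall x y, - e <= G1 x y + G2 x y) ->
  (forall x y, `|x - x0| <= r -> `|y - y0| <= r -> c - e <= G1 x y + G2 x y) ->
  c * (2 * r) * (2 * r) <= e * (2 * K) * (2 * K).
Proof.
move=> dF1 dF2 cF1 cG1 cG2 F1K F2K r0 Kx1 Kx2 Ky1 Ky2 lo lor.
have KK : - K <= K by lra.
have pairc (x : R) : continuous (fun y : R => (x, y)).
  by move=> y; exact: (cvg_pair (F := nbhs y) (f := fun=> x) (g := id) (cvg_cst x) cvg_id).
have cG1x x : continuous (G1 x).
  by move=> y; exact: (@continuous_comp _ _ _ _ (fun p => G1 p.1 p.2) y (pairc x y) (cG1 (x, y))).
have cG2x x : continuous (G2 x).
  by move=> y; exact: (@continuous_comp _ _ _ _ (fun p => G2 p.1 p.2) y (pairc x y) (cG2 (x, y))).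
(* Differentiation under the integral replaces Fubini's theorem: the inner integral of [G1] is the
   derivative of [Psi], which vanishes at both ends, and the inner integral of [G2] is zero by
   itself. *)
pose Psi x := Int (F1 x) (- K) K.
have dPsi x : der Psi x (Int (G1 x) (- K) K).
  apply: Int_param_der => //.
  - by apply: filterE => z; split => // t _; exact: dF1.
  - by move=> t _; exact: cG1.
have E x1 : Int (G1 x1) (- K) K = Int (fun y => G1 x1 y + G2 x1 y) (- K) K.
  rewrite IntD// (IntE KK (cG2x x1) (fun y _ => dF2 x1 y)).
  by have [-> ->] := F2K x1; rewrite subrr addr0.
have cG : continuous (fun x => Int (G1 x) (- K) K).
  move=> x; apply: Int_param_continuous => //; first exact: filterE.
  by move=> t _; exact: cG1.
have Psi0 x : (forall y, F1 x y = 0) -> Psi x = 0.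
  move=> F0; rewrite /Psi (_ : F1 x = fun=> 0) ?Int_cst ?mul0r//.
  by apply/funext.
have : Int (fun x => Int (G1 x) (- K) K) (- K) K = 0.
  rewrite (IntE KK cG (fun x _ => dPsi x)) !Psi0 ?subrr// => y; by case: (F1K y).
have cS x := contD (cG1x x) (cG2x x).
have rr z : z - r <= z + r by lra.
have lo1 x : - K <= x <= K -> - (e * (2 * K)) <= Int (G1 x) (- K) K.
  move=> _; rewrite E.
  have := @Int_lower (fun y => G1 x y + G2 x y) (- K) K K K 0 e
    KK (lexx _) (lexx _) (cS x) (fun y _ => lo x y).
  have -> : K - - K = 2 * K by ring.
  have lo0 y : K <= y <= K -> 0 - e <= G1 x y + G2 x y by rewrite sub0r.
  move=> /(_ lo0) h.
  by apply: le_trans h; rewrite mul0r sub0r.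
have lo2 x : x0 - r <= x <= x0 + r -> c * (2 * r) - e * (2 * K) <= Int (G1 x) (- K) K.
  move=> xr; rewrite E.
  have := @Int_lower (fun y => G1 x y + G2 x y) (- K) (y0 - r) (y0 + r) K c e
    Ky1 (rr y0) Ky2 (cS x) (fun y _ => lo x y).
  have -> : y0 + r - (y0 - r) = 2 * r by ring.
  have -> : K - - K = 2 * K by ring.
  by apply => y yr'; apply: lor; rewrite ler_distl; lra.
have := @Int_lower (fun x => Int (G1 x) (- K) K) (- K) (x0 - r) (x0 + r) K
  (c * (2 * r)) (e * (2 * K)) Kx1 (rr x0) Kx2 cG lo1 lo2.
have -> : x0 + r - (x0 - r) = 2 * r by ring.
have -> : K - - K = 2 * K by ring.
by move=> + h; rewrite h subr_le0.
Qed.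

(* The argument of [u + i v] in ]-pi, pi[; it is smooth off the half-line
   [u <= 0, v = 0]. *)
Definition arg (u v : R) : R := 2 * atan (v / (Num.sqrt (u ^+ 2 + v ^+ 2) + u)).

Lemma der_arg (u v : R -> R) t u' v' : der u t u' -> der v t v' ->
  0 < u t \/ v t != 0 ->
  der (fun s => arg (u s) (v s)) t
    ((u t * v' - v t * u') / (u t ^+ 2 + v t ^+ 2)).
Proof.
move=> du dv uv.
have s0 : 0 < u t ^+ 2 + v t ^+ 2.
  case: uv => [u0|v0]; first by rewrite ltr_pwDl ?exprn_gt0 ?sqr_ge0.
  by rewrite ltr_wpDl ?sqr_ge0// exprn_even_gt0.
pose q s := u s ^+ 2 + v s ^+ 2.
have dq : der q t (2 * u t * u' + 2 * v t * v').
  by apply: derD; exact: der_sqr.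
have dr := @der_comp R Num.sqrt q t _ _ (is_derive1_sqrt s0) dq.
set r := Num.sqrt (u t ^+ 2 + v t ^+ 2) in dr.
have r0 : 0 < r by rewrite sqrtr_gt0.
have rr : r * r = u t ^+ 2 + v t ^+ 2 by rewrite -expr2 sqr_sqrtr// ltW.
have ru : 0 < r + u t.
  case: uv => [u0|v0]; first by rewrite addr_gt0.
  have v2 : 0 < v t ^+ 2 by rewrite exprn_even_gt0.
  by rewrite ltNge; apply/negP => ru; nra.
have dd := derM dv (@derV R (fun s => Num.sqrt (q s) + u s) t _ (lt0r_neq0 ru) (derD dr du)).
apply: der_eq (derMl 2 (@der_comp R atan _ t _ _ (is_derive1_atan _) dd)) _.
rewrite -/r -rr.
have v2 : v t * v t = r * r - u t * u t by rewrite rr; ring.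
(* The quotient is the tangent of the half angle, and v^2 = (r - u)(r + u). *)
have -> : 1 + (v t / (r + u t)) ^+ 2 = 2 * r / (r + u t).
  rewrite expr_div_n [v t ^+ 2]expr2 v2; field; lra.
have -> : v' / (r + u t) + v t * (- ((2 * r)^-1 * (2 * u t * u' + 2 * v t * v') + u') / (r + u t) ^+ 2)
  = v' / (r + u t) - (v t * u t * u' + (v t * v t) * v' + r * v t * u') / r / (r + u t) ^+ 2.
  by field; rewrite !gt_eqF.
by rewrite v2; field; rewrite !gt_eqF.
Qed.

(** The square makes the positive part continuously differentiable, so that the truncated field has
    a continuous divergence across the edge of its support. *)
Definition pos2 x : R := Num.max 0 x ^+ 2.

Lemma pos2_ge_quarter x : 1 / 2 <= x -> 1 / 4 <= pos2 x.
Proof. by move=> x2; rewrite /pos2 max_r; [nra|lra]. Qed.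

Lemma pos2_der x : der pos2 x (2 * Num.max 0 x).
Proof.
apply: derP => e e0; exists e => // z ze.
apply: (@le_trans _ _ (`|z - x| * `|z - x|)); last by rewrite ler_wpM2r// ltW.
rewrite /pos2 -normrM ler_norml.
have -> : `|(z - x) * (z - x)| = (z - x) * (z - x) by rewrite ger0_norm// -expr2 sqr_ge0.
have := sqr_ge0 (z - x); rewrite expr2 => h.
by case: (leP 0 z) => z0; case: (leP 0 x) => x0; apply/andP; split; nra.
Qed.
End Param.

(** * Polynomials in two variables *)

Section Poly.
Variable R : realType.
Local Notation der f t l := (is_derive t (1 : R) f l).
Implicit Types (P Q : bipoly R) (x y : R -> R) (a b t K : R).

Lemma eval2C c a b : eval2 (mpolyC 2 c) a b = c :> R.
Proof. exact: mevalC. Qed.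

Lemma eval2X0 a b : eval2 (mpolyX R (mnm1 ord0)) a b = a :> R.
Proof. by rewrite /eval2 mevalXU. Qed.

Lemma eval2X1 a b : eval2 (mpolyX R (mnm1 (ord_max : 'I_2))) a b = b :> R.
Proof. by rewrite /eval2 mevalXU. Qed.

Lemma eval2D P Q a b : eval2 (P + Q) a b = eval2 P a b + eval2 Q a b.
Proof. exact: rmorphD. Qed.

Lemma eval2M P Q a b : eval2 (P * Q) a b = eval2 P a b * eval2 Q a b.
Proof. exact: rmorphM. Qed.

(** Analytic facts about polynomials need checking only on constants and coordinates, and under sums
    and products. *)
Lemma bipoly_ind (A : bipoly R -> Prop) :
  (forall c, A (mpolyC 2 c)) ->
  A (mpolyX R (mnm1 ord0)) -> A (mpolyX R (mnm1 ord_max)) ->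
  (forall P Q, A P -> A Q -> A (P + Q)) -> (forall P Q, A P -> A Q -> A (P * Q)) ->
  forall P, A P.
Proof.
move=> Ac A0 A1 AD AM; elim/mpolyind; first by rewrite -mpolyC0; exact: Ac.
move=> c m P _ _ hP; apply: (AD) => //; rewrite -mul_mpolyC; apply: (AM) => //.
have AX i k : A (mpolyX R (mnm1 i) ^+ k).
  elim: k => [|k IH]; first by rewrite expr0; exact: (Ac 1).
  rewrite exprS; apply: AM => //.
  case: i {IH} => -[|[|//]] H.
  - by rewrite (_ : Ordinal H = ord0) //; apply: val_inj.
  - by rewrite (_ : Ordinal H = ord_max) //; apply: val_inj.
rewrite mpolyXE_id big_ord_recl big_ord1; exact: AM.
Qed.

Lemma mderivU (i j : 'I_2) :
  mderiv i (mpolyX R (mnm1 j)) = mpolyC 2 (i == j)%:R.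
Proof.
rewrite mderivX mnm1E eq_sym; case: eqP => [->|_]; last by rewrite scale0r mpolyC0.
rewrite scale1r (_ : mnm_sub _ _ = mnm0) ?mpolyX0//.
by apply/mnmP => k; rewrite !mnmE subnn.
Qed.

Lemma eval2_der P x y t (x' y' : R) : der x t x' -> der y t y' ->
  der (fun s => eval2 P (x s) (y s)) t
    (eval2 (mderiv ord0 P) (x t) (y t) * x' +
     eval2 (mderiv ord_max P) (x t) (y t) * y').
Proof.
move=> dx dy; move: P; apply: bipoly_ind => [c|||P Q dP dQ|P Q dP dQ].
- under eq_fun do rewrite eval2C.
  by apply: der_eq (der_cst _ _) _; rewrite !mderivC !eval2C !mul0r addr0.
- under eq_fun do rewrite eval2X0.
  by apply: der_eq dx _; rewrite !mderivU !eval2C !eqE /=; ring.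
- under eq_fun do rewrite eval2X1.
  by apply: der_eq dy _; rewrite !mderivU !eval2C !eqE /=; ring.
- under eq_fun do rewrite eval2D.
  by apply: der_eq (derD dP dQ) _; rewrite !mderivD !eval2D; ring.
- under eq_fun do rewrite eval2M.
  by apply: der_eq (derM dP dQ) _; rewrite !mderivM !eval2D !eval2M; ring.
Qed.

Lemma eval2_continuous P : continuous (fun z : R * R => eval2 P z.1 z.2).
Proof.
move: P; apply: bipoly_ind => [c|||P Q dP dQ|P Q dP dQ].
- under eq_fun do rewrite eval2C; exact: cont_cst.
- under eq_fun do rewrite eval2X0; move=> z; exact: cvg_fst.
- under eq_fun do rewrite eval2X1; move=> z; exact: cvg_snd.
- under eq_fun do rewrite eval2D; exact: contD.
- under eq_fun do rewrite eval2M; exact: contM.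
Qed.

(** The bound and the Lipschitz estimate go together because the estimate for a product uses the
    bounds of its factors. *)
Lemma eval2_lipschitz P K : exists2 L, 0 <= L &
  forall a b a' b', `|a| <= K -> `|b| <= K -> `|a'| <= K -> `|b'| <= K ->
   `|eval2 P a b| <= L /\
   `|eval2 P a b - eval2 P a' b'| <= L * (`|a - a'| + `|b - b'|).
Proof.
move: P; apply: bipoly_ind => [c|||P Q [L L0 HP] [M M0 HQ]|P Q [L L0 HP] [M M0 HQ]].
- exists `|c| => // a b a' b' _ _ _ _; rewrite !eval2C subrr normr0; split => //.
- exists (`|K| + 1) => [|a b a' b' aK _ _ _]; first by rewrite addr_ge0.
  rewrite !eval2X0; have KK := ler_norm K; split; first lra.
  have := normr_ge0 (a - a'); have := normr_ge0 (b - b'); have := normr_ge0 K; nra.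
- exists (`|K| + 1) => [|a b a' b' _ aK _ _]; first by rewrite addr_ge0.
  rewrite !eval2X1; have KK := ler_norm K; split; first lra.
  have := normr_ge0 (a - a'); have := normr_ge0 (b - b'); have := normr_ge0 K; nra.
- exists (L + M) => [|a b a' b' aK bK a'K b'K]; first by rewrite addr_ge0.
  have [P1 P2] := HP _ _ _ _ aK bK a'K b'K.
  have [Q1 Q2] := HQ _ _ _ _ aK bK a'K b'K.
  rewrite !eval2D; split; first by rewrite (le_trans (ler_normD _ _))// lerD.
  rewrite opprD addrACA mulrDl (le_trans (ler_normD _ _))// lerD//.
- exists (2 * L * M + L * M) => [|a b a' b' aK bK a'K b'K].
    by rewrite addr_ge0// !mulr_ge0.
  have [P1 P2] := HP _ _ _ _ aK bK a'K b'K.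
  have [Q1 Q2] := HQ _ _ _ _ aK bK a'K b'K.
  have [P1' _] := HP _ _ _ _ a'K b'K aK bK.
  rewrite !eval2M; split.
    by rewrite normrM (le_trans (ler_pM _ _ P1 Q1))// lerDr !mulr_ge0.
  have -> : eval2 P a b * eval2 Q a b - eval2 P a' b' * eval2 Q a' b' =
    (eval2 P a b - eval2 P a' b') * eval2 Q a b +
    eval2 P a' b' * (eval2 Q a b - eval2 Q a' b') by ring.
  rewrite (le_trans (ler_normD _ _))// !normrM.
  have := ler_pM (normr_ge0 _) (normr_ge0 _) P2 Q1.
  have := ler_pM (normr_ge0 _) (normr_ge0 _) P1' Q2.
  have : 0 <= L * M * (`|a - a'| + `|b - b'|) by rewrite !mulr_ge0// addr_ge0.
  lra.
Qed.

(** The form in which both uniqueness of solutions and the estimate of the potential along the flow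
    use smoothness of the field: the inner product of z - z' with X(z) - X(z') is at most L |z -
    z'|^2. *)
Lemma field_lipschitz P Q K : exists2 L, 0 <= L &
  forall a b a' b', `|a| <= K -> `|b| <= K -> `|a'| <= K -> `|b'| <= K ->
   `|(a - a') * (eval2 P a b - eval2 P a' b') +
     (b - b') * (eval2 Q a b - eval2 Q a' b')| <=
   L * ((a - a') ^+ 2 + (b - b') ^+ 2).
Proof.
have [L L0 HP] := eval2_lipschitz P K; have [M M0 HQ] := eval2_lipschitz Q K.
exists (2 * (L + M)) => [|a b a' b' aK bK a'K b'K].
  by rewrite mulr_ge0// addr_ge0.
have [_ P2] := HP _ _ _ _ aK bK a'K b'K.
have [_ Q2] := HQ _ _ _ _ aK bK a'K b'K.
rewrite (le_trans (ler_normD _ _))// !normrM -(real_normK (num_real (a - a')))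
  -(real_normK (num_real (b - b'))).
move: P2 Q2 (normr_ge0 (a - a')) (normr_ge0 (b - b')).
set u := `|a - a'|; set v := `|b - b'|.
set p := `|eval2 P _ _ - _|; set q := `|eval2 Q _ _ - _| => hp hq u0 v0.
have : u * p <= u * (L * (u + v)) by rewrite ler_wpM2l.
have : v * q <= v * (M * (u + v)) by rewrite ler_wpM2l.
have : 0 <= L * (u - v) ^+ 2 by rewrite mulr_ge0// sqr_ge0.
have : 0 <= M * (u - v) ^+ 2 by rewrite mulr_ge0// sqr_ge0.
have : 0 <= L * v ^+ 2 by rewrite mulr_ge0// sqr_ge0.
have : 0 <= M * u ^+ 2 by rewrite mulr_ge0// sqr_ge0.
have : 0 <= L * u ^+ 2 by rewrite mulr_ge0// sqr_ge0.
have : 0 <= M * v ^+ 2 by rewrite mulr_ge0// sqr_ge0.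
nra.
Qed.

End Poly.

(** * Winding numbers *)

Section Winding.
Variable R : realType.
Local Notation der f t l := (is_derive t (1 : R) f l).

(** Complements [arg]: this branch of the angle is smooth across the half-line u < 0, v = 0, where
    [arg] jumps. *)
Lemma der_atan_ratio (u v : R -> R) t u' v' : der u t u' -> der v t v' ->
  u t != 0 ->
  der (fun s => atan (v s / u s)) t
    ((u t * v' - v t * u') / (u t ^+ 2 + v t ^+ 2)).
Proof.
move=> du dv u0; have dr := derM dv (derV u0 du).
apply: der_eq (@der_comp R atan _ t _ _ (is_derive1_atan _) dr) _.
have s0 : 0 < u t ^+ 2 + v t ^+ 2.
  by rewrite ltr_pwDl ?sqr_ge0// exprn_even_gt0.
by field; rewrite u0 (lt0r_neq0 s0).
Qed.

(** Two parallel vectors with nonpositive inner product have the origin on the segment joining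
    them. *)
Lemma opposite_segment (p q p' q' : R) : p * q' - q * p' = 0 ->
  p * p' + q * q' <= 0 ->
  (forall s, 0 <= s <= 1 -> 0 < (p - s * (p - p')) ^+ 2 + (q - s * (q - q')) ^+ 2) ->
  False.
Proof.
move=> v0 u0 H.
pose D := (p - p') ^+ 2 + (q - q') ^+ 2.
have [D0|D0] := ltP 0 D; last first.
  have D1 : D = 0 by apply/eqP; rewrite eq_le D0 addr_ge0 ?sqr_ge0.
  move/eqP: D1; rewrite paddr_eq0 ?sqr_ge0// !sqrf_eq0 !subr_eq0.
  move=> /andP[/eqP E1 /eqP E2]; subst p' q'.
  have := H 0; rewrite lexx ler01 => /(_ isT); nra.
(* The foot of the perpendicular from the origin; its squared distance is the squared cross product
   over [D]. *)
pose s := (p * (p - p') + q * (q - q')) / D.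
have s01 : 0 <= s <= 1.
  by apply/andP; split; rewrite /s ?ler_pdivrMr ?divr_ge0 ?mul1r// /D; nra.
have := H s s01; suff -> : (p - s * (p - p')) ^+ 2 + (q - s * (q - q')) ^+ 2 =
  (p * q' - q * p') ^+ 2 / D by rewrite v0 expr0n mul0r ltxx.
by rewrite /s /D; field; exact: lt0r_neq0.
Qed.

Lemma arg_gt0 (u v : R) : 0 < v -> 0 < arg u v.
Proof.
move=> v0; rewrite /arg mulr_gt0// -[X in X < _]atan0 lt_atan// divr_gt0//.
have r0 : 0 < u ^+ 2 + v ^+ 2 by rewrite ltr_wpDl ?sqr_ge0// exprn_gt0.
have := sqr_sqrtr (ltW r0); have := sqrtr_ge0 (u ^+ 2 + v ^+ 2).
have : 0 < v ^+ 2 by rewrite exprn_gt0.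
set r := Num.sqrt _ => v2 r1 rr; rewrite ltNge; apply/negP => ru; nra.
Qed.

Lemma argN (u v : R) : arg u (- v) = - arg u v.
Proof. by rewrite /arg sqrrN mulNr atanN mulrN. Qed.

Lemma Int_arg (f u v du dv : R -> R) (a b : R) : a <= b -> continuous f ->
  (forall t, a <= t <= b -> [/\ der u t (du t), der v t (dv t),
     0 < u t \/ v t != 0 &
     f t = (u t * dv t - v t * du t) / (u t ^+ 2 + v t ^+ 2)]) ->
  Int f a b = arg (u b) (v b) - arg (u a) (v a).
Proof.
move=> ab cf H; have dG t : a <= t <= b -> der (fun s => arg (u s) (v s)) t (f t).
  by move=> /H[du' dv' uv ->]; exact: der_arg.
exact: IntE ab cf dG.
Qed.

Lemma Int_atan_ratio (f u v du dv : R -> R) (a b : R) : a <= b -> continuous f ->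
  (forall t, a <= t <= b -> [/\ der u t (du t), der v t (dv t), u t != 0 &
     f t = (u t * dv t - v t * du t) / (u t ^+ 2 + v t ^+ 2)]) ->
  Int f a b = atan (v b / u b) - atan (v a / u a).
Proof.
move=> ab cf H; have dG t : a <= t <= b -> der (fun s => atan (v s / u s)) t (f t).
  by move=> /H[du' dv' uv ->]; exact: der_atan_ratio.
exact: IntE ab cf dG.
Qed.

Variables (x y dx dy : R -> R) (T : R).
Hypothesis T0 : 0 < T.
Hypothesis xder : forall t, der x t (dx t).
Hypothesis yder : forall t, der y t (dy t).
Hypothesis dx_cont : continuous dx.
Hypothesis dy_cont : continuous dy.
Hypothesis xT : x T = x 0.
Hypothesis yT : y T = y 0.

Definition sqdist a b t : R := (x t - a) ^+ 2 + (y t - b) ^+ 2.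

Definition angle_form a b t : R :=
  ((x t - a) * dy t - (y t - b) * dx t) / sqdist a b t.

(* 2 pi times the winding number of the curve around [(a, b)]. *)
Definition winding a b : R := Int (angle_form a b) 0 T.

Let x_cont : continuous x. Proof. by move=> t; exact: der_continuous (xder t). Qed.
Let y_cont : continuous y. Proof. by move=> t; exact: der_continuous (yder t). Qed.

Lemma sqdist_continuous a b : continuous (sqdist a b).
Proof.
have cx : continuous (fun t => x t - a) by exact: (contD x_cont (cont_cst (c := - a))).
have cy : continuous (fun t => y t - b) by exact: (contD y_cont (cont_cst (c := - b))).
by apply: contD; [exact: (contM cx cx)|exact: (contM cy cy)].
Qed.

Lemma angle_form_continuous a b : (forall t, 0 < sqdist a b t) ->
  continuous (angle_form a b).
Proof.
move=> off.
have cx : continuous (fun t => x t - a) by exact: (contD x_cont (cont_cst (c := - a))).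
have cy : continuous (fun t => y t - b) by exact: (contD y_cont (cont_cst (c := - b))).
have cnum := contB (contM cx dy_cont) (contM cy dx_cont).
have cinv := contV (@sqdist_continuous a b) (fun t => lt0r_neq0 (off t)).
exact: (contM cnum cinv).
Qed.

(* With z, z' the end points and g the curve, the difference of the two angle
   forms is the angle form of (g - z') conj(g - z), and this product lies on the
   negative half-line exactly when g lies between z and z'. *)
Lemma winding_segment a b a' b' :
  (forall t s, 0 <= s <= 1 -> 0 < sqdist (a + s * (a' - a)) (b + s * (b' - b)) t) ->
  winding a' b' = winding a b.
Proof.
move=> H.
have off t : 0 < sqdist a b t.
  by have := H t 0; rewrite !mul0r !addr0 lexx ler01; exact.
have off' t : 0 < sqdist a' b' t.
  by have := H t 1; rewrite !mul1r ![_ + (_ - _)]addrC !subrK lexx ler01; exact.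
have c := angle_form_continuous off; have c' := angle_form_continuous off'.
have cN := contMl (c := -1) c.
pose u t := (x t - a) * (x t - a') + (y t - b) * (y t - b').
pose v t := (x t - a) * (y t - b') - (y t - b) * (x t - a').
pose du t := dx t * (x t - a') + (x t - a) * dx t + (dy t * (y t - b') + (y t - b) * dy t).
pose dv t := dx t * (y t - b') + (x t - a) * dy t - (dy t * (x t - a') + (y t - b) * dx t).
have dsub (g dg : R -> R) t k : der g t (dg t) -> der (fun s => g s - k) t (dg t).
  by move=> dg'; apply: der_eq (derB dg' (der_cst k t)) _; rewrite subr0.
have I0 : Int (fun t => angle_form a' b' t + -1 * angle_form a b t) 0 T =
    arg (u T) (v T) - arg (u 0) (v 0).
  apply: (@Int_arg _ u v du dv) (ltW T0) (contD c' cN) _ => t _; split.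
  - by apply: derD; apply: derM; exact: dsub.
  - by apply: derB; apply: derM; exact: dsub.
  - have [u0|u0] := ltP 0 (u t); [by left|right].
    apply/eqP => v0; apply: (@opposite_segment (x t - a) (y t - b) (x t - a') (y t - b')) => //.
    move=> s s01; have := H t s s01; congr (0 < _); rewrite /sqdist; ring.
  - have o := lt0r_neq0 (off t); have o' := lt0r_neq0 (off' t).
    rewrite /angle_form (_ : u t ^+ 2 + v t ^+ 2 = sqdist a b t * sqdist a' b' t).
      rewrite (_ : u t * dv t - v t * du t =
        ((x t - a') * dy t - (y t - b') * dx t) * sqdist a b t -
        ((x t - a) * dy t - (y t - b) * dx t) * sqdist a' b' t).
        by field; rewrite o o'.
      by rewrite /u /v /du /dv /sqdist; ring.
    by rewrite /u /v /sqdist; ring.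
move: I0; rewrite /u /v xT yT subrr IntD ?(ltW T0)// IntZ ?(ltW T0)//.
by rewrite /winding => I0; lra.
Qed.

(** Here u + i v = -(g - z) conj z, with z the point and g the curve. It meets the negative
    half-line only when g meets the ray from z away from the origin, so [arg] follows the angle
    along the whole closed curve and returns to its initial value. *)
Lemma winding_ray a b : 0 < a ^+ 2 + b ^+ 2 ->
  (forall t s, 0 <= s -> 0 < sqdist (a + s * a) (b + s * b) t) ->
  winding a b = 0.
Proof.
move=> z0 H.
have off t : 0 < sqdist a b t.
  by have := H t 0; rewrite !mul0r !addr0 lexx; exact.
have c := angle_form_continuous off.
pose u t := - ((x t - a) * a + (y t - b) * b).
pose v t := - ((y t - b) * a - (x t - a) * b).
pose du t := - (a * dx t + b * dy t).
pose dv t := - (a * dy t - b * dx t).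
have dsub (g dg : R -> R) t k m : der g t (dg t) ->
    der (fun s => (g s - k) * m) t (m * dg t).
  move=> dg'; have := derM (derB dg' (der_cst k t)) (der_cst m t).
  by move/der_eq; apply; rewrite subr0 mulr0 addr0 mulrC.
rewrite /winding (@Int_arg _ u v du dv) ?(ltW T0)//.
  by rewrite /u /v xT yT subrr.
move=> t _; split.
- by apply: derN; apply: derD; exact: dsub.
- by apply: derN; apply: derB; exact: dsub.
- have [u0|u0] := ltP 0 (u t); [by left|right].
  apply/eqP => v0.
  (* As v = 0, the curve is at the point z + s z of the ray. *)
  pose s := - u t / (a ^+ 2 + b ^+ 2).
  have s0 : 0 <= s by rewrite divr_ge0 ?(ltW z0)// oppr_ge0.
  have := H t s s0.
  suff -> : sqdist (a + s * a) (b + s * b) t = v t ^+ 2 / (a ^+ 2 + b ^+ 2).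
    by rewrite v0 expr0n mul0r ltxx.
  by rewrite /sqdist /s /v /u; field; exact: lt0r_neq0.
- have o := lt0r_neq0 (off t); have o' := lt0r_neq0 z0.
  rewrite /angle_form (_ : u t ^+ 2 + v t ^+ 2 = sqdist a b t * (a ^+ 2 + b ^+ 2)).
    rewrite (_ : u t * dv t - v t * du t =
      ((x t - a) * dy t - (y t - b) * dx t) * (a ^+ 2 + b ^+ 2)).
      by field; rewrite o o'.
    by rewrite /u /v /du /dv; ring.
  by rewrite /u /v /sqdist; ring.
Qed.

(* For z, z' on either side of g(0) along the normal, (g - z') conj(g - z)
   meets the negative half-line only at t = 0; near t = 0 and t = T the angle is
   followed by atan (v / u), in between by [arg], and the three increments have
   the same sign. *)
Lemma winding_jump (e d : R) : 0 < e -> 0 < d -> 2 * d <= T ->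
  0 < dx 0 ^+ 2 + dy 0 ^+ 2 ->
  (forall t, 0 < t <= d -> 0 < (x t - x 0) * dx 0 + (y t - y 0) * dy 0) ->
  (forall t, 0 < t <= d -> (x (T - t) - x 0) * dx 0 + (y (T - t) - y 0) * dy 0 < 0) ->
  (forall t, d <= t <= T - d -> e ^+ 2 * (dx 0 ^+ 2 + dy 0 ^+ 2) < sqdist (x 0) (y 0) t) ->
  (forall t, 0 < sqdist (x 0 - e * dy 0) (y 0 + e * dx 0) t) ->
  (forall t, 0 < sqdist (x 0 + e * dy 0) (y 0 - e * dx 0) t) ->
  winding (x 0 + e * dy 0) (y 0 - e * dx 0) < winding (x 0 - e * dy 0) (y 0 + e * dx 0).
Proof.
move=> e0 d0 dT n0 H1 H2 H3.
set a := x 0 - e * dy 0; set b := y 0 + e * dx 0.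
set a' := x 0 + e * dy 0; set b' := y 0 - e * dx 0 => off off'.
have c := angle_form_continuous off; have c' := angle_form_continuous off'.
have cN := contMl (c := -1) c.
pose f t := angle_form a' b' t + -1 * angle_form a b t.
have cf : continuous f by exact: (contD c' cN).
pose n2 := dx 0 ^+ 2 + dy 0 ^+ 2.
(* Real and imaginary part of (g - z') conj(g - z): z and z' are symmetric about g(0), so the
   products collapse to |g - g(0)|^2 - e^2 |g'(0)|^2 and to 2 e times the component of g - g(0)
   along g'(0). *)
pose u t := sqdist (x 0) (y 0) t - e ^+ 2 * n2.
pose v t := 2 * e * ((x t - x 0) * dx 0 + (y t - y 0) * dy 0).
pose du t := 2 * (x t - x 0) * dx t + 2 * (y t - y 0) * dy t.
pose dv t := 2 * e * (dx t * dx 0 + dy t * dy 0).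
have dsub (g dg : R -> R) t k : der g t (dg t) -> der (fun s => g s - k) t (dg t).
  by move=> dg'; apply: der_eq (derB dg' (der_cst k t)) _; rewrite subr0.
have dut t : der u t (du t).
  by apply: (dsub (sqdist (x 0) (y 0)) du); apply: derD; apply: der_sqr; exact: dsub.
have dvt t : der v t (dv t).
  apply: derMl; apply: derD.
    by apply: der_eq (derM (dsub x dx t (x 0) (xder t)) (der_cst _ _)) _; ring.
  by apply: der_eq (derM (dsub y dy t (y 0) (yder t)) (der_cst _ _)) _; ring.
have fE t : f t = (u t * dv t - v t * du t) / (u t ^+ 2 + v t ^+ 2).
  have o := lt0r_neq0 (off t); have o' := lt0r_neq0 (off' t).
  rewrite /f /angle_form (_ : u t ^+ 2 + v t ^+ 2 = sqdist a b t * sqdist a' b' t).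
    rewrite (_ : u t * dv t - v t * du t =
      ((x t - a') * dy t - (y t - b') * dx t) * sqdist a b t -
      ((x t - a) * dy t - (y t - b) * dx t) * sqdist a' b' t).
      by field; rewrite o o'.
    by rewrite /u /v /du /dv /n2 /sqdist /a /b /a' /b'; ring.
  by rewrite /u /v /n2 /sqdist /a /b /a' /b'; ring.
have u0 : u 0 < 0.
  by rewrite /u /sqdist !subrr expr0n /= addr0 sub0r oppr_lt0 mulr_gt0 ?exprn_gt0.
have uT : u T = u 0 by rewrite /u /sqdist xT yT.
have v0 : v 0 = 0 by rewrite /v !subrr !mul0r addr0 mulr0.
have vT : v T = 0 by rewrite /v xT yT !subrr !mul0r addr0 mulr0.
have uneg t0 : u t0 < 0 -> exists2 r, 0 < r & forall t, `|t - t0| < r -> u t < 0.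
  move=> ut0; apply: near_distP.
  exact: (der_continuous (dut t0)) (lt_nbhsl ut0).
have [r1 r10 h1] := uneg 0 u0.
have [|r2 r20 h2] := uneg T; first by rewrite uT.
pose h := Num.min d (Num.min r1 r2) / 2.
have m0 : 0 < Num.min d (Num.min r1 r2) by rewrite !lt_min d0 r10 r20.
have hm : Num.min d (Num.min r1 r2) <= d by rewrite ge_min lexx.
have hm1 : Num.min d (Num.min r1 r2) <= r1 by rewrite !ge_min lexx orbT.
have hm2 : Num.min d (Num.min r1 r2) <= r2 by rewrite !ge_min lexx !orbT.
have h0 : 0 < h by rewrite /h; lra.
have hd : h < d by rewrite /h; lra.
have hr1 : h < r1 by rewrite /h; lra.
have hr2 : h < r2 by rewrite /h; lra.
have vpos t : 0 < t <= d -> 0 < v t by move=> /H1 ?; rewrite !mulr_gt0.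
have vneg t : 0 < t <= d -> v (T - t) < 0 by move=> /H2 ?; rewrite pmulr_rlt0// mulr_gt0.
have vh : 0 < v h by apply: vpos; lra.
have vTh : v (T - h) < 0 by apply: vneg; lra.
have uh : u h < 0 by apply: h1; rewrite subr0 ger0_norm ?ltW.
have uTh : u (T - h) < 0 by apply: h2; rewrite addrAC subrr sub0r normrN ger0_norm ?ltW.
have I1 : Int f 0 h = atan (v h / u h) - atan (v 0 / u 0).
  apply: (@Int_atan_ratio f u v du dv) (ltW h0) cf _ => t /andP[t0 th]; split => //.
  by apply/ltr0_neq0/h1; rewrite subr0 ger0_norm//; lra.
have I2 : Int f h (T - h) = arg (u (T - h)) (v (T - h)) - arg (u h) (v h).
  apply: (@Int_arg f u v du dv) _ cf _ => [|t /andP[t1 t2]]; first lra.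
  split => //.
  have [td|td] := leP t d; first by right; apply/lt0r_neq0/vpos; lra.
  have [td'|td'] := leP (T - d) t; last first.
    by left; rewrite subr_gt0; apply: H3; lra.
  right; rewrite -[t](subKr T); apply/ltr0_neq0/vneg; lra.
have I3 : Int f (T - h) T = atan (v T / u T) - atan (v (T - h) / u (T - h)).
  apply: (@Int_atan_ratio f u v du dv) _ cf _ => [|t /andP[t1 t2]]; first lra.
  split => //; apply/ltr0_neq0/h2; rewrite ler0_norm; lra.
(* The end values do not cancel because the two branches of the angle differ by pi in absolute value
   where they meet. The total is -2 pi, but its sign suffices. *)
have : Int f 0 T < 0.
  rewrite -(Int_cat f 0 h T) -(Int_cat f h (T - h) T) I1 I2 I3 v0 vT !mul0r atan0 sub0r subr0.
  have a1 : atan (v h / u h) < 0.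
    by rewrite -[X in _ < X]atan0 lt_atan// pmulr_rlt0// invr_lt0.
  have a2 : 0 < arg (u h) (v h) by exact: arg_gt0.
  have a3 : arg (u (T - h)) (v (T - h)) < 0.
    by rewrite -oppr_gt0 -argN arg_gt0// oppr_gt0.
  have a4 : 0 < atan (v (T - h) / u (T - h)).
    by rewrite -[X in X < _]atan0 lt_atan// nmulr_rgt0// invr_lt0.
  lra.
rewrite /f IntD ?(ltW T0)// IntZ ?(ltW T0)// /winding; lra.
Qed.

End Winding.

(** * Periodic solutions *)

Section Periodic.
Variable R : realType.

(** The reduced time precedes the function in the quantifiers, so that one time serves both
    coordinates of a solution. *)
Lemma periodic_reduce (T t : R) : 0 < T -> exists2 t', 0 <= t' <= T &
  forall f : R -> R, (forall s, f (s + T) = f s) -> f t = f t'.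
Proof.
move=> T0; exists (t - (Num.floor (t / T))%:~R * T).
  have /andP[h1 h2] := floor_itv (t / T).
  rewrite ler_pdivlMr// in h1; rewrite intrD ltr_pdivrMr// mulrDl mul1r in h2.
  by apply/andP; split; lra.
move=> f fT.
have fn n s : f (s + n%:R * T) = f s.
  elim: n => [|n IH]; first by rewrite mul0r addr0.
  by rewrite -natr1 mulrDl mul1r addrA fT IH.
case: (Num.floor (t / T)) => n.
  by rewrite -{1}[t](subrK (n%:R * T)) fn.
by rewrite NegzE mulrNz mulNr opprK fn.
Qed.

Lemma periodic_min (f : R -> R) (T : R) : 0 < T -> continuous f ->
  (forall s, f (s + T) = f s) -> exists t0, forall t, f t0 <= f t.
Proof.
move=> T0 cf fT.
have [t0 _ H] := EVT_min (ltW T0) (continuous_subspaceT cf).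
exists t0 => t; have [t' t'T ->] := periodic_reduce t T0; last exact: fT.
by apply: H; rewrite in_itv.
Qed.

Lemma periodic_bounded (f : R -> R) (T : R) : 0 < T -> continuous f ->
  (forall s, f (s + T) = f s) -> exists K, forall t, `|f t| <= K.
Proof.
move=> T0 cf fT.
have [t0 H0] := periodic_min T0 cf fT.
have [|t1 H1] := @periodic_min (fun t => -1 * f t) _ T0 (contMl cf).
  by move=> s; rewrite fT.
exists (`|f t0| + `|f t1|) => t; rewrite ler_norml.
have := H0 t; have := H1 t; have := ler_norm (f t1); have := ler_norm (- f t0).
rewrite normrN; have := normr_ge0 (f t1); have := normr_ge0 (f t0).
by move=> *; apply/andP; split; lra.
Qed.

End Periodic.

(** * Uniqueness of solutions and minimal periods *)

Section Flow.
Variables (R : realType) (P Q : bipoly R).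
Local Notation der f t l := (is_derive t (1 : R) f l).
Implicit Types (x y : R -> R).

Definition solution x y : Prop := forall t,
  der x t (eval2 P (x t) (y t)) /\ der y t (eval2 Q (x t) (y t)).

(* The squared distance E of two solutions satisfies |E'| <= 2 L E. *)
Lemma solution_unique x1 y1 x2 y2 K t0 : solution x1 y1 -> solution x2 y2 ->
  (forall t, [/\ `|x1 t| <= K, `|y1 t| <= K, `|x2 t| <= K & `|y2 t| <= K]) ->
  x1 t0 = x2 t0 -> y1 t0 = y2 t0 -> forall t, x1 t = x2 t /\ y1 t = y2 t.
Proof.
move=> s1 s2 bd xE yE.
have [L L0 HL] := field_lipschitz P Q K.
pose E t := (x1 t - x2 t) ^+ 2 + (y1 t - y2 t) ^+ 2.
pose dE t := 2 * ((x1 t - x2 t) * (eval2 P (x1 t) (y1 t) - eval2 P (x2 t) (y2 t)) +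
  (y1 t - y2 t) * (eval2 Q (x1 t) (y1 t) - eval2 Q (x2 t) (y2 t))).
have E0 t : 0 <= E t by rewrite addr_ge0 ?sqr_ge0.
have dEP t : der E t (dE t).
  have [[d1 d2] [d3 d4]] := (s1 t, s2 t).
  by apply: der_eq (derD (der_sqr (derB d1 d3)) (der_sqr (derB d2 d4))) _; rewrite /dE; ring.
have dEle t : `|dE t| <= 2 * L * E t.
  have [h1 h2 h3 h4] := bd t.
  rewrite /dE normrM ger0_norm// -mulrA ler_pM2l//; exact: HL.
have Et0 : E t0 = 0 by rewrite /E xE yE !subrr expr0n addr0.
have dG k t : der (fun s => E s * expR (k * s)) t ((dE t + k * E t) * expR (k * t)).
  have de : der (fun s => expR (k * s)) t (expR (k * t) * k).
    by apply: (@der_comp R expR _ t _ _ (is_derive_expR _));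
       apply: der_eq (derMl k (der_id t)) _; rewrite mulr1.
  by apply: der_eq (derM (dEP t) de) _; ring.
move=> t; suff Et : E t <= 0.
  have /eqP : E t = 0 by apply/eqP; rewrite eq_le Et E0.
  by rewrite paddr_eq0 ?sqr_ge0// !sqrf_eq0 !subr_eq0 => /andP[/eqP ? /eqP ?].
(* Gronwall in both directions of time: E exp(-2 L t) is nonincreasing and E exp(2 L t) is
   nondecreasing. *)
have [t0t|/ltW tt0] := leP t0 t.
  have := @der_ge0 R (fun s => -1 * (E s * expR (- (2 * L) * s))) _ _ _ t0t
    (fun s _ => derMl (-1) (dG _ s)).
  rewrite Et0 mul0r mulr0 mulN1r oppr_ge0 pmulr_lle0 ?expR_gt0//; apply=> s _.
  rewrite mulN1r -mulNr mulr_ge0 ?expR_ge0//.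
  by have := dEle s; rewrite ler_norml => /andP[]; lra.
have := @der_ge0 R (fun s => E s * expR (2 * L * s)) _ _ _ tt0 (fun s _ => dG _ s).
rewrite Et0 mul0r pmulr_lle0 ?expR_gt0//; apply=> s _.
rewrite mulr_ge0 ?expR_ge0//.
by have := dEle s; rewrite ler_norml => /andP[]; lra.
Qed.

Lemma solution_shift x y c : solution x y ->
  solution (fun t => x (t + c)) (fun t => y (t + c)).
Proof.
move=> s t; have [dx dy] := s (t + c).
have dc : der (fun s => s + c) t 1.
  by apply: der_eq (derD (der_id t) (der_cst c t)) _; rewrite addr0.
by split; [have := @der_comp R x (fun s => s + c) t _ _ dx dc|have := @der_comp R y (fun s => s + c) t _ _ dy dc]; move/der_eq; apply; rewrite mulr1.
Qed.

Lemma solution_continuous x y : solution x y -> continuous x /\ continuous y.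
Proof. by move=> s; split=> t; have [dx dy] := s t; [exact: der_continuous dx|exact: der_continuous dy]. Qed.

Section PeriodicSolution.
Variables (x y : R -> R) (T : R).
Hypothesis per : periodic_solution P Q x y T.

Lemma periodic_sol : solution x y.
Proof. by have [h1 h2 _ _ _] := per; split. Qed.

Lemma period_gt0 : 0 < T. Proof. by have [] := per. Qed.

Lemma periodicE t : x (t + T) = x t /\ y (t + T) = y t.
Proof. by have [_ _ _ /(_ t)] := per. Qed.

Lemma eval2_sol_continuous (F : bipoly R) : continuous (fun t => eval2 F (x t) (y t)).
Proof.
move=> t; have [dx dy] := periodic_sol t.
exact: der_continuous (eval2_der F dx dy).
Qed.

Lemma periodic_solution_bounded : exists K, forall t, `|x t| <= K /\ `|y t| <= K.
Proof.
have [cx cy] := solution_continuous periodic_sol.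
have [K1 H1] := periodic_bounded period_gt0 cx (fun t => (periodicE t).1).
have [K2 H2] := periodic_bounded period_gt0 cy (fun t => (periodicE t).2).
exists (`|K1| + `|K2|) => t; have := H1 t; have := H2 t.
have := ler_norm K1; have := ler_norm K2.
have := normr_ge0 K1; have := normr_ge0 K2; lra.
Qed.

(** At an equilibrium the constant solution passes through the same point, and uniqueness would make
    the periodic solution constant. *)
Lemma velocity_gt0 t : 0 < eval2 P (x t) (y t) ^+ 2 + eval2 Q (x t) (y t) ^+ 2.
Proof.
rewrite lt0r addr_ge0 ?sqr_ge0// andbT paddr_eq0 ?sqr_ge0// !sqrf_eq0.
apply/negP => /andP[/eqP P0 /eqP Q0].
have s0 : solution (fun=> x t) (fun=> y t).
  by move=> t'; rewrite P0 Q0; split; exact: der_cst.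
have [K HK] := periodic_solution_bounded.
have H := @solution_unique _ _ _ _ K t periodic_sol s0 _ erefl erefl.
have [_ _ _ _ [t']] := per; apply.
have {}H := H (fun s => And4 (HK s).1 (HK s).2 (HK t).1 (HK t).2).
by have [-> ->] := H t'; have [-> ->] := H 0.
Qed.

Lemma sqdist_gt0 a b t : (x t, y t) <> (a, b) -> 0 < sqdist x y a b t.
Proof.
move=> H; rewrite lt0r addr_ge0 ?sqr_ge0// andbT paddr_eq0 ?sqr_ge0// !sqrf_eq0 !subr_eq0.
by apply/negP => /andP[/eqP E1 /eqP E2]; apply: H; rewrite E1 E2.
Qed.

Lemma sqdist_lower a b : (forall t, (x t, y t) <> (a, b)) ->
  exists2 c, 0 < c & forall t, c <= sqdist x y a b t.
Proof.
move=> H.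
have [t0 H0] : exists t0, forall t, sqdist x y a b t0 <= sqdist x y a b t.
  apply: (periodic_min period_gt0); last first.
    by move=> s; rewrite /sqdist; have [-> ->] := periodicE s.
  move=> t; have [dx dy] := periodic_sol t.
  have dxa := derB dx (der_cst a t); have dyb := derB dy (der_cst b t).
  exact: der_continuous (derD (der_sqr dxa) (der_sqr dyb)).
by exists (sqdist x y a b t0) => //; exact: sqdist_gt0.
Qed.

End PeriodicSolution.

Lemma periodic_orbit_meet x1 y1 T1 x2 y2 T2 t1 t2 :
  periodic_solution P Q x1 y1 T1 -> periodic_solution P Q x2 y2 T2 ->
  (x1 t1, y1 t1) = (x2 t2, y2 t2) -> orbit_of x1 y1 = orbit_of x2 y2.
Proof.
move=> p1 p2 [xE yE].
have [K1 H1] := periodic_solution_bounded p1.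
have [K2 H2] := periodic_solution_bounded p2.
have s1 := periodic_sol p1; have s2 := solution_shift (t2 - t1) (periodic_sol p2).
have := @solution_unique _ _ _ _ (`|K1| + `|K2|) t1 s1 s2 _ _ _.
rewrite ![t1 + _]addrC subrK => /(_ _ xE yE) H.
have {}H t : x1 t = x2 (t + (t2 - t1)) /\ y1 t = y2 (t + (t2 - t1)).
  apply: H => {}t; have := H1 t; have := H2 (t + (t2 - t1)).
  have := ler_norm K1; have := ler_norm K2.
  have := normr_ge0 K1; have := normr_ge0 K2.
  by move=> ? ? ? ? [? ?] [? ?]; split; lra.
rewrite eqEsubset; split => z [t _ <-] /=.
  by exists (t + (t2 - t1)) => //; have [-> ->] := H t.
by exists (t - (t2 - t1)) => //; have [-> ->] := H (t - (t2 - t1)); rewrite subrK.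
Qed.

(** The jump of the winding number is computed near the starting point, so the curve must not return
    there in the middle of the period. The bounds near both ends come from continuity of the
    velocity. *)
Lemma minimal_period x y T0 : periodic_solution P Q x y T0 ->
  let p := eval2 P (x 0) (y 0) in let q := eval2 Q (x 0) (y 0) in
  exists T d, [/\ periodic_solution P Q x y T, 0 < d, 2 * d <= T,
   forall t, 0 < t <= d -> 0 < (x t - x 0) * p + (y t - y 0) * q &
   (forall t, 0 < t <= d -> (x (T - t) - x 0) * p + (y (T - t) - y 0) * q < 0) /\
   forall t, d <= t <= T - d -> 0 < sqdist x y (x 0) (y 0) t].
Proof.
move=> per p q; have sol := periodic_sol per.
pose h t := (x t - x 0) * p + (y t - y 0) * q.
pose dh t := eval2 P (x t) (y t) * p + eval2 Q (x t) (y t) * q.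
have dhP t : der h t (dh t).
  have [dx dy] := sol t.
  have d1 := derM (derB dx (der_cst (x 0) t)) (der_cst p t).
  have d2 := derM (derB dy (der_cst (y 0) t)) (der_cst q t).
  by apply: der_eq (derD d1 d2) _; rewrite /dh; ring.
have dhc : continuous dh.
  apply: contD; apply: contM; try exact: cont_cst; exact: (eval2_sol_continuous per).
have dh0 : 0 < dh 0 by have := velocity_gt0 per 0; rewrite /dh -!expr2.
have [d1 d10 Hd] := near_distP (dhc 0 _ (lt_nbhsr dh0)).
have h0 : h 0 = 0 by rewrite /h !subrr !mul0r addr0.
have hpos t : 0 < t < d1 -> 0 < h t.
  move=> /andP[t0 td]; rewrite -h0; apply: (der_gt0 t0 (fun s _ => dhP s)) => s st.
  by apply: Hd; rewrite subr0 ger0_norm; lra.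
have hneg t : 0 < t < d1 -> h (- t) < 0.
  move=> /andP[t0 td]; rewrite -h0.
  have t0' : - t < 0 by rewrite oppr_lt0.
  apply: (der_gt0 t0' (fun s _ => dhP s)) => s st.
  by apply: Hd; rewrite subr0 ler0_norm; lra.
pose D := sqdist x y (x 0) (y 0).
have cD : continuous D.
  move=> t; have [dx dy] := sol t.
  have dxa := derB dx (der_cst (x 0) t); have dyb := derB dy (der_cst (y 0) t).
  exact: der_continuous (derD (der_sqr dxa) (der_sqr dyb)).
have D0 t : D t = 0 -> x t = x 0 /\ y t = y 0.
  move=> /eqP; rewrite paddr_eq0 ?sqr_ge0// !sqrf_eq0 !subr_eq0.
  by move=> /andP[/eqP ? /eqP ?].
have Dh t : 0 < t -> D t = 0 -> d1 <= t.
  move=> t0 /D0[E1 E2]; rewrite leNgt; apply/negP => td.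
  have := hpos t; rewrite t0 td => /(_ isT).
  by rewrite /h E1 E2 !subrr !mul0r addr0 ltxx.
(* There is no return to the starting point before [d1], as [h] is positive until then. The return
   times in [S] thus form a compact set, whose least element is a period by uniqueness. *)
pose S := `[d1, T0] `&` (D @^-1` [set 0]).
have T00 := period_gt0 per.
have DT0 : D T0 = 0.
  by have [] := periodicE per 0; rewrite add0r /D /sqdist => -> ->; rewrite !subrr expr0n addr0.
have S0 : S !=set0.
  by exists T0; split => //=; rewrite in_itv/= lexx andbT; exact: Dh.
have cS : compact S.
  apply: (subclosed_compact _ (@segment_compact _ d1 T0)); last by move=> z [].
  apply: closedI; first exact: interval_closed.
  by apply: preimage_closed => //; exact: closed_eq.
have cid : {within S, continuous (@id R)} by apply: continuous_subspaceT => z; exact: cvg_id.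
have [T /set_mem[Td DT] Tmin] := compact_EVT_min S0 cS cid.
move: Td; rewrite /= in_itv/= => /andP[Td TT0].
have T_gt0 : 0 < T by lra.
have perT : periodic_solution P Q x y T.
  have [E1 E2] := D0 T DT.
  have [K HK] := periodic_solution_bounded per.
  have H t : x (t + T) = x t /\ y (t + T) = y t.
    apply: (@solution_unique _ _ _ _ K 0 (solution_shift T sol) sol); rewrite ?add0r//.
    by move=> s; have [? ?] := HK s; have [? ?] := HK (s + T); split.
  by have [? ? _ _ ?] := per; split.
exists T, (d1 / 2); split => //; first lra.
- lra.
- move=> t /andP[t0 td]; apply: hpos; lra.
- split=> [t /andP[t0 td]|t /andP[td1 td2]].
    have := periodicE perT (- t); rewrite [- t + T]addrC => -[-> ->].
    by apply: hneg; lra.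
  rewrite lt0r addr_ge0 ?sqr_ge0// andbT; apply/eqP => Dt0.
  have d1t : d1 <= t by apply: Dh => //; lra.
  have tT : t < T by lra.
  have /Tmin : t \in S.
    by apply/mem_set; split => //=; rewrite in_itv/= d1t/= (le_trans (ltW tT)).
  by rewrite leNgt tT.
Qed.

End Flow.

(** * Separation by two periodic orbits *)

Section Separation.
Variables (R : realType) (P Q : bipoly R).
Local Notation der f t l := (is_derive t (1 : R) f l).
Implicit Types (x y : R -> R).

Let vel (F : bipoly R) x y : R -> R := fun t => eval2 F (x t) (y t).

Let turns x y T : R -> R -> R := winding x y (vel P x y) (vel Q x y) T.

Definition avoids x y (a b : R) : Prop := forall t, 0 < sqdist x y a b t.

(** From |p + q|^2 <= 2 |p|^2 + 2 |q|^2, whence the factor 2. *)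
Lemma sqdist_perturb x y (a b a' b' c : R) t : c <= sqdist x y a b t ->
  2 * ((a' - a) ^+ 2 + (b' - b) ^+ 2) < c -> 0 < sqdist x y a' b' t.
Proof.
rewrite /sqdist => h1 h2.
have := sqr_ge0 (x t - a' - (a' - a)); have := sqr_ge0 (y t - b' - (b' - b)); nra.
Qed.

Lemma avoids_box x y T (a b : R) : periodic_solution P Q x y T -> avoids x y a b ->
  exists2 r, 0 < r & forall a' b', `|a' - a| <= r -> `|b' - b| <= r -> avoids x y a' b'.
Proof.
move=> per off.
have [t E|c c0 H] := sqdist_lower per (a := a) (b := b).
  case: E => E1 E2; have := off t; rewrite /sqdist E1 E2 !subrr expr0n addr0 ltxx//.
have c10 : 0 < 1 + c by lra.
(* Then 4 r <= c and 4 r < 1, so that 2 (r^2 + r^2) < c. *)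
pose r := c / (4 * (1 + c)).
have r0 : 0 < r by rewrite divr_gt0// mulr_gt0.
have rE : r * (4 * (1 + c)) = c by rewrite divfK// gt_eqF// mulr_gt0.
have rc0 : 0 < r * c by rewrite mulr_gt0.
have rc : 4 * r <= c by lra.
have r1 : 4 * r < 1 by rewrite ltNge; apply/negP => r1; nra.
exists r => // a' b' ha hb t; apply: (sqdist_perturb (H t)).
have sq (k : R) : `|k| <= r -> k ^+ 2 <= r * r.
  by move=> kr; rewrite -real_normK ?num_real// expr2 ler_pM.
have := sq _ ha; have := sq _ hb; nra.
Qed.

(** The two points lie close to ([x 0], [y 0]) on either side of the first curve, and the segment
    joining them misses the second. The period [T2] stays universal so that this and its mirror
    image can be used with one common pair of periods. *)
Lemma winding_jump_exists x y T x' y' T' :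
  periodic_solution P Q x y T -> periodic_solution P Q x' y' T' ->
  (forall t t', (x t, y t) <> (x' t', y' t')) ->
  exists2 T1, periodic_solution P Q x y T1 & forall T2, periodic_solution P Q x' y' T2 ->
  exists a b a' b', [/\ avoids x y a b, avoids x y a' b',
    avoids x' y' a b, avoids x' y' a' b' &
    turns x y T1 a b <> turns x y T1 a' b' /\
    turns x' y' T2 a b = turns x' y' T2 a' b'].
Proof.
move=> per0 per' disj.
have [T1 [d [per d0 dT H1 [H2 H3]]]] := minimal_period per0.
exists T1 => // T2 per2; have sol := periodic_sol per; have sol' := periodic_sol per'.
have T10 := period_gt0 per.
set p := eval2 P (x 0) (y 0) in H1 H2; set q := eval2 Q (x 0) (y 0) in H1 H2.
have n0 : 0 < p ^+ 2 + q ^+ 2 by exact: velocity_gt0 per 0.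
have [c0 c00 Hc0] : exists2 c, 0 < c &
    forall t, d <= t <= T1 - d -> c <= sqdist x y (x 0) (y 0) t.
  have cD : continuous (sqdist x y (x 0) (y 0)).
    move=> t; have [dx dy] := sol t.
    have dxa := derB dx (der_cst (x 0) t); have dyb := derB dy (der_cst (y 0) t).
    exact: der_continuous (derD (der_sqr dxa) (der_sqr dyb)).
  have dd : d <= T1 - d by lra.
  have [t0 t0d H] := EVT_min dd (continuous_subspaceT cD).
  exists (sqdist x y (x 0) (y 0) t0) => [|t td]; first by apply: H3; rewrite in_itv in t0d.
  by apply: H; rewrite in_itv.
have [c1 c10 Hc1] : exists2 c, 0 < c & forall t, c <= sqdist x' y' (x 0) (y 0) t.
  by apply: (sqdist_lower per') => t /esym; exact: disj.
pose n2 := p ^+ 2 + q ^+ 2.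
pose c := Num.min c0 c1.
have cpos : 0 < c by rewrite lt_min c00.
have cc0 : c <= c0 by rewrite ge_min lexx.
have cc1 : c <= c1 by rewrite ge_min lexx orbT.
(* The bound 1 gives e^2 <= e, so the squared displacement e^2 n2 is at most c / 4. *)
pose e := Num.min 1 (c / (4 * n2)).
have e0 : 0 < e by rewrite lt_min ltr01 divr_gt0// mulr_gt0.
have en : 4 * (e ^+ 2 * n2) <= c.
  have e1 : e <= 1 by rewrite ge_min lexx.
  have : e <= c / (4 * n2) by rewrite ge_min lexx orbT.
  rewrite ler_pdivlMr ?mulr_gt0// => h.
  have : e ^+ 2 * n2 <= e * n2.
    by rewrite ler_wpM2r ?(ltW n0)// expr2 ler_piMr// ltW.
  lra.
have dist1 (k : R) : `|k| <= e -> k ^+ 2 <= e ^+ 2.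
  by move=> ke; rewrite -(real_normK (num_real k)) ler_pXn2r ?nnegrE// ltW.
have away (k : R) : `|k| <= e -> avoids x' y' (x 0 + k * q) (y 0 - k * p).
  move=> /dist1 ke t; apply: (sqdist_perturb (Hc1 t)).
  have : k ^+ 2 * n2 <= e ^+ 2 * n2 by rewrite ler_wpM2r// ltW.
  by rewrite (_ : 2 * _ = 2 * (k ^+ 2 * n2)); [lra|rewrite /n2; ring].
pose h t := (x t - x 0) * p + (y t - y 0) * q.
have off2 : avoids x y (x 0 - e * q) (y 0 + e * p) /\
    avoids x y (x 0 + e * q) (y 0 - e * p).
  (* The product of the two squared distances is u^2 + v^2 for u, v as in [winding_jump], so both
     are positive once u and v have no common zero. Over one period v vanishes only at the ends,
     where u < 0, or in the middle, where u > 0. *)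
  suff H t : 0 < sqdist x y (x 0 - e * q) (y 0 + e * p) t *
      sqdist x y (x 0 + e * q) (y 0 - e * p) t.
    have D0 a b t : 0 <= sqdist x y a b t by rewrite addr_ge0 ?sqr_ge0.
    split=> t; rewrite lt0r D0 andbT; apply/eqP => D1; have := H t;
      by rewrite D1 ?mul0r ?mulr0 ltxx.
  have [t' t'T Et] := periodic_reduce t T10.
  have [xE yE] : x t = x t' /\ y t = y t'.
    by split; apply: Et => s; case: (periodicE per s).
  have sE a b : sqdist x y a b t = sqdist x y a b t' by rewrite /sqdist xE yE.
  rewrite !sE.
  have -> : sqdist x y (x 0 - e * q) (y 0 + e * p) t' *
      sqdist x y (x 0 + e * q) (y 0 - e * p) t' =
    (sqdist x y (x 0) (y 0) t' - e ^+ 2 * n2) ^+ 2 + (2 * e * h t') ^+ 2.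
    by rewrite /sqdist /h /n2; ring.
  have [u0|u0] := eqVneq (h t') 0; last first.
    by rewrite ltr_wpDl ?sqr_ge0// exprn_even_gt0//= !mulf_neq0// gt_eqF.
  rewrite ltr_pwDl ?sqr_ge0// exprn_even_gt0//= subr_eq0.
  move: t'T => /andP[t'0 t'T].
  have n2e : 0 < e ^+ 2 * n2 by rewrite mulr_gt0// exprn_gt0.
  have D00 : sqdist x y (x 0) (y 0) 0 = 0 by rewrite /sqdist !subrr expr0n addr0.
  have [t0|t0] := leP t' 0.
    by rewrite (_ : t' = 0) ?D00 ?lt_eqF//; lra.
  have [td|td] := leP t' d.
    by have := H1 t'; rewrite -/(h t') u0 t0 td ltxx => /(_ isT).
  have [tT|tT] := leP t' (T1 - d).
    by rewrite gt_eqF// (lt_le_trans _ (Hc0 t' _))//; lra.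
  have [tT1|tT1] := leP T1 t'.
    have -> : t' = 0 + T1 by lra.
    rewrite (_ : sqdist _ _ _ _ _ = 0) ?lt_eqF// /sqdist.
    by have [-> ->] := periodicE per 0; rewrite !subrr expr0n addr0.
  have tt : 0 < T1 - t' <= d by lra.
  by have := H2 _ tt; rewrite subKr -/(h t') u0 ltxx.
have [off off'] := off2.
exists (x 0 + e * q), (y 0 - e * p), (x 0 - e * q), (y 0 + e * p); split => //.
- by apply: away; rewrite ger0_norm ?lexx ?(ltW e0).
- have := away (- e); rewrite !mulNr opprK normrN ger0_norm ?(ltW e0)//; exact.
split.
  apply/eqP; rewrite lt_eqF//.
  apply: (@winding_jump R x y (vel P x y) (vel Q x y) T1 T10 _ _ _ _ _ _ e d) => //.
  - by move=> t; case: (sol t).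
  - by move=> t; case: (sol t).
  - exact: (eval2_sol_continuous per).
  - exact: (eval2_sol_continuous per).
  - by have [] := periodicE per 0; rewrite add0r.
  - by have [] := periodicE per 0; rewrite add0r.
  - move=> t /Hc0; apply: lt_le_trans; rewrite -/n2 /vel -/p -/q -/n2; nra.
apply: (@winding_segment R x' y' (vel P x' y') (vel Q x' y') T2).
- exact: period_gt0 per2.
- by move=> t; case: (sol' t).
- by move=> t; case: (sol' t).
- exact: (eval2_sol_continuous per').
- exact: (eval2_sol_continuous per').
- by have [] := periodicE per2 0; rewrite add0r.
- by have [] := periodicE per2 0; rewrite add0r.
- move=> t s s01.
  have -> : x 0 - e * q + s * (x 0 + e * q - (x 0 - e * q)) = x 0 + (2 * s - 1) * e * q by ring.
  have -> : y 0 + e * p + s * (y 0 - e * p - (y 0 + e * p)) = y 0 - (2 * s - 1) * e * p by ring.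
  by apply: away; rewrite normrM (ger0_norm (ltW e0)) ler_piMl ?(ltW e0)// ler_norml; lra.
Qed.

Lemma turns_segment x y T a b a' b' : periodic_solution P Q x y T ->
  (forall s, 0 <= s <= 1 -> avoids x y (a + s * (a' - a)) (b + s * (b' - b))) ->
  turns x y T a' b' = turns x y T a b.
Proof.
move=> per H; have sol := periodic_sol per.
apply: (@winding_segment R x y (vel P x y) (vel Q x y) T).
- exact: period_gt0 per.
- by move=> t; case: (sol t).
- by move=> t; case: (sol t).
- exact: (eval2_sol_continuous per).
- exact: (eval2_sol_continuous per).
- by have [] := periodicE per 0; rewrite add0r.
- by have [] := periodicE per 0; rewrite add0r.
- by move=> t s /H; apply.
Qed.

Lemma avoids_norm x y a b : (forall t, x t ^+ 2 + y t ^+ 2 <> a ^+ 2 + b ^+ 2) ->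
  avoids x y a b.
Proof.
move=> H t; rewrite lt0r addr_ge0 ?sqr_ge0// andbT paddr_eq0 ?sqr_ge0// !sqrf_eq0 !subr_eq0.
by apply/negP => /andP[/eqP E1 /eqP E2]; apply: (H t); rewrite E1 E2.
Qed.

Lemma turns_inside x y T (m a b : R) : periodic_solution P Q x y T ->
  (forall t, m <= x t ^+ 2 + y t ^+ 2) -> a ^+ 2 + b ^+ 2 < m ->
  turns x y T a b = turns x y T 0 0.
Proof.
move=> per H zm; apply: turns_segment => // s /andP[s0 s1].
rewrite !add0r !subr0; apply: avoids_norm => t E.
have := H t; rewrite E !exprMn -mulrDr leNgt => /negP; apply.
apply: le_lt_trans zm; rewrite ler_piMl ?addr_ge0 ?sqr_ge0//.
by rewrite expr2; nra.
Qed.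

Lemma turns_outside x y T (m a b : R) : periodic_solution P Q x y T ->
  (forall t, x t ^+ 2 + y t ^+ 2 <= m) -> m < a ^+ 2 + b ^+ 2 -> turns x y T a b = 0.
Proof.
move=> per H zm; have sol := periodic_sol per.
have z0 : 0 < a ^+ 2 + b ^+ 2.
  by apply: le_lt_trans zm; apply: le_trans (H 0); rewrite addr_ge0 ?sqr_ge0.
apply: (@winding_ray R x y (vel P x y) (vel Q x y) T) => //.
- exact: period_gt0 per.
- by move=> t; case: (sol t).
- by move=> t; case: (sol t).
- exact: (eval2_sol_continuous per).
- exact: (eval2_sol_continuous per).
- by have [] := periodicE per 0; rewrite add0r.
- by have [] := periodicE per 0; rewrite add0r.
- move=> t s s0; move: t; apply: avoids_norm => t E.
  have := H t; rewrite E leNgt => /negP; apply; apply: (lt_le_trans zm).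
  have -> : (a + s * a) ^+ 2 + (b + s * b) ^+ 2 = (1 + s) ^+ 2 * (a ^+ 2 + b ^+ 2) by ring.
  by rewrite ler_peMl ?(ltW z0)//; nra.
Qed.

Lemma turns_loc x y T (a b : R) : periodic_solution P Q x y T -> avoids x y a b ->
  exists2 r, 0 < r & forall a' b', `|a' - a| <= r -> `|b' - b| <= r ->
    avoids x y a' b' /\ turns x y T a' b' = turns x y T a b.
Proof.
move=> per off; have [r r0 H] := avoids_box per off.
exists r => // a' b' ha hb; split; first exact: H.
apply: turns_segment => // s /andP[s0 s1].
apply: H; rewrite addrAC subrr add0r normrM (ger0_norm s0); exact: le_trans (ler_piMl (normr_ge0 _) s1) _.
Qed.

(** [D] is a nonzero level set of [chi]. Local constancy of membership off the orbits gives both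
    that [D] is open and that its boundary lies on the orbits; the bounds hold because [chi]
    vanishes inside and outside the annulus. *)
Lemma separation x1 y1 T1 x2 y2 T2 (m M : R) :
  periodic_solution P Q x1 y1 T1 -> periodic_solution P Q x2 y2 T2 ->
  (forall t t', (x1 t, y1 t) <> (x2 t', y2 t')) -> 0 < m ->
  (forall t, m <= x1 t ^+ 2 + y1 t ^+ 2 <= M) ->
  (forall t, m <= x2 t ^+ 2 + y2 t ^+ 2 <= M) ->
  exists D : R -> R -> Prop, [/\ exists a b, D a b,
    forall a b, D a b -> avoids x1 y1 a b /\ avoids x2 y2 a b,
    forall a b, avoids x1 y1 a b -> avoids x2 y2 a b -> exists2 r, 0 < r &
      forall a' b', `|a' - a| <= r -> `|b' - b| <= r -> D a' b' <-> D a b &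
    forall a b, D a b -> m <= a ^+ 2 + b ^+ 2 <= M].
Proof.
move=> per1' per2' disj m0 H1 H2.
have disj' t t' : (x2 t, y2 t) <> (x1 t', y1 t') by apply: nesym; exact: disj.
have [S1 per1 J1] := winding_jump_exists per1' per2' disj.
have [S2 per2 J2] := winding_jump_exists per2' per1' disj'.
have h1 t : m <= x1 t ^+ 2 + y1 t ^+ 2 by case/andP: (H1 t).
have h1' t : x1 t ^+ 2 + y1 t ^+ 2 <= M by case/andP: (H1 t).
have h2 t : m <= x2 t ^+ 2 + y2 t ^+ 2 by case/andP: (H2 t).
have h2' t : x2 t ^+ 2 + y2 t ^+ 2 <= M by case/andP: (H2 t).
pose w1 := turns x1 y1 S1 0 0; pose w2 := turns x2 y2 S2 0 0.
pose k1 := if w1 == 0 then 1 else - w2; pose k2 := if w1 == 0 then 0 else w1.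
(* The coefficients are chosen so that [chi] vanishes at the origin, without
   both being zero. *)
pose chi a b := k1 * turns x1 y1 S1 a b + k2 * turns x2 y2 S2 a b.
have chi_in a b : a ^+ 2 + b ^+ 2 < m -> chi a b = 0.
  move=> ab; rewrite /chi (turns_inside per1 h1 ab) (turns_inside per2 h2 ab).
  by rewrite -/w1 -/w2 /k1 /k2; case: eqP => [->|_]; ring.
have chi_out a b : M < a ^+ 2 + b ^+ 2 -> chi a b = 0.
  move=> ab; rewrite /chi (turns_outside per1 h1' ab) (turns_outside per2 h2' ab).
  by rewrite !mulr0 addr0.
have [a [b [off1 off2 chi0]]] : exists a b,
    [/\ avoids x1 y1 a b, avoids x2 y2 a b & chi a b <> 0].
  (* Crossing an orbit whose coefficient is nonzero changes [chi], so [chi] is nonzero on at least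
     one side. *)
  have [k20|k20] := eqVneq k2 0.
    have k1E : k1 = 1 by move: k20; rewrite /k1 /k2; case: eqP.
    have [a [b [a' [b' [f1 f1' f2 f2' [J _]]]]]] := J1 _ per2.
    rewrite /chi k20 k1E.
    have [E|E] := eqVneq (turns x1 y1 S1 a b) 0.
      exists a', b'; split => //; rewrite mul1r mul0r addr0 => E'.
      by apply: J; rewrite E E'.
    by exists a, b; split => //; rewrite mul1r mul0r addr0; exact/eqP.
  have [a [b [a' [b' [f2 f2' f1 f1' [J J']]]]]] := J2 _ per1.
  have [E|E] := eqVneq (chi a b) 0; last by exists a, b; split => //; exact/eqP.
  exists a', b'; split => // E'; apply: J; apply: (mulfI k20).
  by move: E' E; rewrite /chi J'; lra.
exists (fun a' b' => [/\ avoids x1 y1 a' b', avoids x2 y2 a' b' & chi a' b' = chi a b]).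
split.
- by exists a, b.
- by move=> a' b' [].
- move=> a1 b1 o1 o2.
  have [r1 r10 R1] := turns_loc per1 o1; have [r2 r20 R2] := turns_loc per2 o2.
  exists (Num.min r1 r2); first by rewrite lt_min r10.
  move=> a' b'; rewrite !le_min => /andP[ha1 ha2] /andP[hb1 hb2].
  have [f1' E1] := R1 _ _ ha1 hb1; have [f2' E2] := R2 _ _ ha2 hb2.
  have -> : chi a' b' = chi a1 b1 by rewrite /chi E1 E2.
  by split=> -[].
- move=> a' b' [_ _ E]; apply/andP; split; rewrite leNgt; apply/negP => h.
    by apply: chi0; rewrite -E chi_in.
  by apply: chi0; rewrite -E chi_out.
Qed.

End Separation.

(** * A potential that blows up on a periodic orbit *)

Section Potential.
Variables (R : realType) (P Q : bipoly R).
Local Notation der f t l := (is_derive t (1 : R) f l).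
Variables (x y : R -> R) (T : R).
Hypothesis per : periodic_solution P Q x y T.

Let sol := periodic_sol per.
Let T0 : 0 <= 2 * T.
Proof. by rewrite mulr_ge0// ltW// (period_gt0 per). Qed.
Let cx : continuous x. Proof. by case: (solution_continuous sol). Qed.
Let cy : continuous y. Proof. by case: (solution_continuous sol). Qed.

Lemma near_box (a b r : R) : 0 < r ->
  \forall z \near ((a, b) : R * R), `|z.1 - a| <= r /\ `|z.2 - b| <= r.
Proof.
move=> r0; exists ([set u | `|u - a| < r], [set u | `|u - b| < r]) => /=.
  by split; exact: near_dist.
by move=> [u v] [/= /ltW ? /ltW ?].
Qed.

Lemma near_boxP (a b : R) (A : R -> R -> Prop) :
  (\forall z \near ((a, b) : R * R), A z.1 z.2) -> exists2 r, 0 < r &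
    forall a' b', `|a' - a| <= r -> `|b' - b| <= r -> A a' b'.
Proof.
move=> [[A1 A2] /= [/near_distP[r1 r10 h1] /near_distP[r2 r20 h2]] H].
exists (Num.min r1 r2 / 2); first by rewrite divr_gt0// lt_min r10.
have : Num.min r1 r2 <= r1 by rewrite ge_min lexx.
have : Num.min r1 r2 <= r2 by rewrite ge_min lexx orbT.
move=> m2 m1 a' b' ha hb; apply: (H (a', b')); split; [apply: h1|apply: h2] => /=; lra.
Qed.

Lemma avoids_near (a b : R) : avoids x y a b ->
  \forall z \near ((a, b) : R * R), avoids x y z.1 z.2.
Proof.
move=> /(avoids_box per)[r r0 H]; have := near_box a b r0.
by apply: filterS => z [h1 h2]; exact: H.
Qed.

Section Kernel.
Variables (Z : topologicalType) (u v : Z -> R).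
Hypotheses (cu : continuous u) (cv : continuous v).

Let lift1 (f : Z -> R) : continuous f -> continuous (fun p : Z * R => f p.1).
Proof.
by move=> cf p; exact: (@continuous_comp _ _ _ fst f p (@cvg_fst _ _ _ _ _) (cf p.1)).
Qed.

Let lift2 (f : R -> R) : continuous f -> continuous (fun p : Z * R => f p.2).
Proof.
by move=> cf p; exact: (@continuous_comp _ _ _ snd f p (@cvg_snd _ _ _ _ _) (cf p.2)).
Qed.

(** The parameter space is the plane for joint continuity and a line for the partial derivatives. *)
Lemma kernel_continuous z t : 0 < sqdist x y (u z) (v z) t ->
  {for (z, t), continuous (fun p : Z * R => (sqdist x y (u p.1) (v p.1) p.2)^-1)}.
Proof.
move=> D0.
have c1 := contB (lift2 cx) (lift1 cu); have c2 := contB (lift2 cy) (lift1 cv).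
have cD := contD (contM c1 c1) (contM c2 c2).
exact: (@continuousV _ _ _ (z, t) (lt0r_neq0 D0) (cD (z, t))).
Qed.

Lemma dkernel_continuous (w : Z -> R) (f : R -> R) z t : continuous w -> continuous f ->
  0 < sqdist x y (u z) (v z) t ->
  {for (z, t), continuous (fun p : Z * R => 2 * (f p.2 - w p.1) *
    ((sqdist x y (u p.1) (v p.1) p.2)^-1 * (sqdist x y (u p.1) (v p.1) p.2)^-1))}.
Proof.
move=> cw cf D0.
have c1 := contMl (c := 2) (contB (lift2 cf) (lift1 cw)).
have k := kernel_continuous D0.
exact: (@continuousM _ _ _ _ _ (c1 (z, t)) (@continuousM _ _ _ _ _ k k)).
Qed.
End Kernel.

(* Integrating over two periods lets the integral contain a full interval
   [t, t + r] to the right of any t in [0, T]. *)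
Definition potential (a b : R) : R :=
  Int (fun t => (sqdist x y a b t)^-1) 0 (2 * T).

(** Both partial derivatives of [potential]: with [x] and c = a the one in a, with [y] and c = b the
    one in b. *)
Definition dpotential (f : R -> R) (c a b : R) : R :=
  Int (fun t => 2 * (f t - c) * ((sqdist x y a b t)^-1 * (sqdist x y a b t)^-1)) 0 (2 * T).

Let inv_cont a b : avoids x y a b -> continuous (fun t => (sqdist x y a b t)^-1).
Proof.
move=> off; apply: contV => [|t]; last exact: lt0r_neq0.
have c1 : continuous (fun t => x t - a) by apply: contB => //; exact: cont_cst.
have c2 : continuous (fun t => y t - b) by apply: contB => //; exact: cont_cst.
exact: (contD (contM c1 c1) (contM c2 c2)).
Qed.

Let dinv_cont (f : R -> R) (c a b : R) : continuous f -> avoids x y a b -> continuous (fun t =>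
  2 * (f t - c) * ((sqdist x y a b t)^-1 * (sqdist x y a b t)^-1)).
Proof.
move=> cf off; apply: contM; last by apply: contM; exact: inv_cont.
by apply: contMl; apply: contB => //; exact: cont_cst.
Qed.

Lemma potential_continuous a b : avoids x y a b ->
  {for (a, b), continuous (fun z : R * R => potential z.1 z.2)}.
Proof.
move=> off; apply: (@Int_param_continuous R _
  (fun (z : R * R) t => (sqdist x y z.1 z.2 t)^-1)) => //.
- by have := avoids_near off; apply: filterS => z; exact: inv_cont.
- move=> t _; apply: (@kernel_continuous _ fst snd) => //.
  + by move=> z; exact: cvg_fst.
  + by move=> z; exact: cvg_snd.
Qed.

Lemma dpotential_continuous a b : avoids x y a b ->
  {for (a, b), continuous (fun z : R * R => dpotential x z.1 z.1 z.2)} /\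
  {for (a, b), continuous (fun z : R * R => dpotential y z.2 z.1 z.2)}.
Proof.
have c1 : continuous (fst : R * R -> R) by move=> z; exact: cvg_fst.
have c2 : continuous (snd : R * R -> R) by move=> z; exact: cvg_snd.
move=> off; split.
- apply: (@Int_param_continuous R _ (fun (z : R * R) t =>
    2 * (x t - z.1) * ((sqdist x y z.1 z.2 t)^-1 * (sqdist x y z.1 z.2 t)^-1))) => //.
    by have := avoids_near off; apply: filterS => z; exact: dinv_cont.
  by move=> t _; exact: (@dkernel_continuous _ fst snd c1 c2 fst x).
- apply: (@Int_param_continuous R _ (fun (z : R * R) t =>
    2 * (y t - z.2) * ((sqdist x y z.1 z.2 t)^-1 * (sqdist x y z.1 z.2 t)^-1))) => //.
    by have := avoids_near off; apply: filterS => z; exact: dinv_cont.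
  by move=> t _; exact: (@dkernel_continuous _ fst snd c1 c2 snd y).
Qed.

Lemma potential_der a b : avoids x y a b ->
  der (fun a' => potential a' b) a (dpotential x a a b) /\
  der (fun b' => potential a b') b (dpotential y b a b).
Proof.
move=> off; have [r r0 H] := avoids_box per off.
have cid : continuous (fun z : R => z) by move=> z; exact: cvg_id.
have dsub k z : der (fun z => k - z) z (-1).
  by apply: der_eq (derB (der_cst k z) (der_id z)) _; rewrite sub0r.
split.
- apply: (@Int_param_der R (fun a' t => (sqdist x y a' b t)^-1) (fun a' t =>
    2 * (x t - a') * ((sqdist x y a' b t)^-1 * (sqdist x y a' b t)^-1))) => //.
  + have := near_dist a r0; apply: filterS => a' aa'.
    have off' : avoids x y a' b by apply: H; rewrite ?subrr ?normr0 ltW.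
    split=> [|t _]; first exact: inv_cont.
    have dD : der (fun z => sqdist x y z b t) a' (- (2 * (x t - a'))).
      by apply: der_eq (derD (der_sqr (dsub (x t) a')) (der_cst ((y t - b) ^+ 2) a')) _; ring.
    apply: der_eq (@derV R (fun z => sqdist x y z b t) a' _ (lt0r_neq0 (off' t)) dD) _.
    by rewrite opprK expr2 invfM.
  + exact: dinv_cont.
  + move=> t _; apply: (@dkernel_continuous _ (fun z => z) (fun=> b) cid _ (fun z => z) x) => //.
    exact: cont_cst.
- apply: (@Int_param_der R (fun b' t => (sqdist x y a b' t)^-1) (fun b' t =>
    2 * (y t - b') * ((sqdist x y a b' t)^-1 * (sqdist x y a b' t)^-1))) => //.
  + have := near_dist b r0; apply: filterS => b' bb'.
    have off' : avoids x y a b' by apply: H; rewrite ?subrr ?normr0 ltW.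
    split=> [|t _]; first exact: inv_cont.
    have dD : der (fun z => sqdist x y a z t) b' (- (2 * (y t - b'))).
      by apply: der_eq (derD (der_cst ((x t - a) ^+ 2) b') (der_sqr (dsub (y t) b'))) _; ring.
    apply: der_eq (@derV R (fun z => sqdist x y a z t) b' _ (lt0r_neq0 (off' t)) dD) _.
    by rewrite opprK expr2 invfM.
  + exact: dinv_cont.
  + move=> t _; apply: (@dkernel_continuous _ (fun=> a) (fun z => z) _ cid (fun z => z) y) => //.
    exact: cont_cst.
Qed.

Lemma potential_ge0 a b : avoids x y a b -> 0 <= potential a b.
Proof.
move=> off; rewrite -(mul0r (2 * T - 0)) -Int_cst//; apply: Int_le => //.
- exact: cont_cst.
- exact: inv_cont.
- by move=> t _; rewrite invr_ge0 ltW.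
Qed.

(* The derivative of [1 / sqdist] along the curve has zero integral; subtracting
   it replaces the field at [(a, b)] by its difference with the field on the
   curve, which is at most L times the distance. *)
Lemma potential_flow a b K L : avoids x y a b -> `|a| <= K -> `|b| <= K ->
  (forall t, `|x t| <= K /\ `|y t| <= K) ->
  (forall a b a' b', `|a| <= K -> `|b| <= K -> `|a'| <= K -> `|b'| <= K ->
   `|(a - a') * (eval2 P a b - eval2 P a' b') +
     (b - b') * (eval2 Q a b - eval2 Q a' b')| <=
   L * ((a - a') ^+ 2 + (b - b') ^+ 2)) ->
  `|dpotential x a a b * eval2 P a b + dpotential y b a b * eval2 Q a b| <=
  2 * L * potential a b.
Proof.
move=> off aK bK bd HL.
pose D := sqdist x y a b.
pose g t := -2 * ((x t - a) * eval2 P (x t) (y t) + (y t - b) * eval2 Q (x t) (y t)) *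
  ((D t)^-1 * (D t)^-1).
have ci : continuous (fun t => (D t)^-1) by exact: inv_cont.
have cg : continuous g.
  have cP := eval2_sol_continuous (F := P) per; have cQ := eval2_sol_continuous (F := Q) per.
  have c1 := contB cx (@cont_cst R R a); have c2 := contB cy (@cont_cst R R b).
  exact: (contM (contMl (c := -2) (contD (contM c1 cP) (contM c2 cQ))) (contM ci ci)).
have Ig : Int g 0 (2 * T) = 0.
  have dD t : 0 <= t <= 2 * T -> der (fun t => (D t)^-1) t (g t).
    move=> _; have [dx dy] := sol t.
    have dxa := derB dx (der_cst a t); have dyb := derB dy (der_cst b t).
    apply: der_eq (@derV R D t _ (lt0r_neq0 (off t)) (derD (der_sqr dxa) (der_sqr dyb))) _.
    by rewrite /g /D; field; exact: lt0r_neq0.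
  rewrite (IntE T0 cg dD) (_ : D (2 * T) = D 0) ?subrr// /D /sqdist.
  have [h1 h2] := periodicE per 0; have [h3 h4] := periodicE per (0 + T).
  have -> : 2 * T = 0 + T + T by ring.
  by rewrite h3 h4 h1 h2.
pose h t := eval2 P a b * (2 * (x t - a) * ((D t)^-1 * (D t)^-1)) +
  (eval2 Q a b * (2 * (y t - b) * ((D t)^-1 * (D t)^-1)) + g t).
have c1 := contMl (c := eval2 P a b) (dinv_cont (c := a) cx off).
have c2 := contMl (c := eval2 Q a b) (dinv_cont (c := b) cy off).
have c3 := contD c2 cg.
have ch := contD c1 c3.
have -> : dpotential x a a b * eval2 P a b + dpotential y b a b * eval2 Q a b = Int h 0 (2 * T).
  rewrite /h (IntD T0 c1 c3) (IntD T0 c2 cg) Ig addr0.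
  rewrite (IntZ _ T0 (dinv_cont (c := a) cx off)) (IntZ _ T0 (dinv_cont (c := b) cy off)).
  by rewrite /dpotential; ring.
(* The factor 1 / D^2 from differentiating 1 / D meets a Lipschitz bound L D, which leaves the
   integrand of the potential. *)
have hle t : `|h t| <= 2 * L * (D t)^-1.
  have [xK yK] := bd t; have D0 := off t.
  have -> : h t = -2 * ((D t)^-1 * (D t)^-1) *
     ((a - x t) * (eval2 P a b - eval2 P (x t) (y t)) +
      (b - y t) * (eval2 Q a b - eval2 Q (x t) (y t))) by rewrite /h /g; ring.
  rewrite normrM.
  have -> : `|-2 * ((D t)^-1 * (D t)^-1)| = 2 * ((D t)^-1 * (D t)^-1).
    by rewrite normrM ler0_norm ?opprK ?ger0_norm// ?mulr_ge0// ?invr_ge0 ?ltW//; lra.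
  have -> : 2 * L * (D t)^-1 = 2 * ((D t)^-1 * (D t)^-1) * (L * ((a - x t) ^+ 2 + (b - y t) ^+ 2)).
    have -> : (a - x t) ^+ 2 + (b - y t) ^+ 2 = D t by rewrite /D /sqdist; ring.
    by field; exact: lt0r_neq0.
  by rewrite ler_wpM2l ?HL// !mulr_ge0 ?invr_ge0 ?ltW.
have cN := contMl (c := 2 * L) ci; have cN' := contMl (c := - (2 * L)) ci.
rewrite ler_norml /potential -mulNr -!IntZ//; apply/andP; split; apply: Int_le => // t _.
  by rewrite mulNr; have := hle t; rewrite ler_norml => /andP[].
by have := hle t; rewrite ler_norml => /andP[].
Qed.

(** The speed is bounded, so a curve that starts within r of the point stays within O(r) of it for a
    time r. There the integrand is at least 1 / (k r^2), which contributes 1 / (k r). *)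
Lemma potential_blowup t0 (N : R) : exists2 r, 0 < r & forall a b,
  `|a - x t0| <= r -> `|b - y t0| <= r -> avoids x y a b -> N <= potential a b.
Proof.
have Tpos := period_gt0 per.
have [t1 /andP[t10 t1T] Et] := periodic_reduce t0 Tpos.
have -> : x t0 = x t1 by apply: Et => s; case: (periodicE per s).
have -> : y t0 = y t1 by apply: Et => s; case: (periodicE per s).
have vper (F : bipoly R) s : eval2 F (x (s + T)) (y (s + T)) = eval2 F (x s) (y s).
  by have [-> ->] := periodicE per s.
have [C1 HC1] := periodic_bounded Tpos (eval2_sol_continuous (F := P) per) (vper P).
have [C2 HC2] := periodic_bounded Tpos (eval2_sol_continuous (F := Q) per) (vper Q).
pose C := `|C1| + `|C2| + 1.
have C0 : 0 < C by rewrite ltr_wpDl// addr_ge0.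
have HC s : `|eval2 P (x s) (y s)| <= C /\ `|eval2 Q (x s) (y s)| <= C.
  have := HC1 s; have := HC2 s; have := ler_norm C1; have := ler_norm C2.
  by have := normr_ge0 C1; have := normr_ge0 C2; rewrite /C; lra.
have CC : 0 < C + 1 by lra.
pose k := 2 * (C + 1) ^+ 2.
have k0 : 0 < k by rewrite mulr_gt0// exprn_gt0.
pose N' := `|N| + 1.
have N'0 : 0 < N' by rewrite ltr_wpDl.
(* The bound [T] keeps [t1, t1 + r] inside two periods; the other one gives 1 / (k r) >= N'. *)
pose r := Num.min T (k * N')^-1.
have r0 : 0 < r by rewrite lt_min Tpos invr_gt0 mulr_gt0.
have rT : r <= T by rewrite ge_min lexx.
have rN : r * k * N' <= 1.
  have : r <= (k * N')^-1 by rewrite ge_min lexx orbT.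
  by rewrite -[X in _ <= X]mul1r ler_pdivlMr ?mulr_gt0// mulrA.
exists r => // a b ha hb off.
have ci := inv_cont off.
have growth (f df : R -> R) s : (forall t, der f t (df t)) -> (forall t, `|df t| <= C) ->
    t1 <= s <= t1 + r -> `|f s - f t1| <= C * r.
  move=> dfP dfC /andP[s1 s2].
  have [c _ ->] := der_MVT s1 (fun t _ => dfP t).
  rewrite normrM ler_pM// ger0_norm; lra.
have Dle s : t1 <= s <= t1 + r -> sqdist x y a b s <= k * r ^+ 2.
  move=> st.
  have gx := growth x _ s (fun t => (sol t).1) (fun t => (HC t).1) st.
  have gy := growth y _ s (fun t => (sol t).2) (fun t => (HC t).2) st.
  have sq (u : R) : `|u| <= (C + 1) * r -> u ^+ 2 <= (C + 1) ^+ 2 * r ^+ 2.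
    move=> ur; rewrite -exprMn -(real_normK (num_real u)) ler_pXn2r// nnegrE//.
    by rewrite mulr_ge0 ?ltW.
  have -> : k * r ^+ 2 = (C + 1) ^+ 2 * r ^+ 2 + (C + 1) ^+ 2 * r ^+ 2 by rewrite /k; ring.
  rewrite lerD// sq//.
    have -> : x s - a = (x s - x t1) - (a - x t1) by ring.
    by apply: le_trans (ler_normB _ _) _; lra.
  have -> : y s - b = (y s - y t1) - (b - y t1) by ring.
  by apply: le_trans (ler_normB _ _) _; lra.
have N_le : N <= (k * r ^+ 2)^-1 * (t1 + r - t1).
  have -> : (k * r ^+ 2)^-1 * (t1 + r - t1) = (k * r)^-1.
    by field; rewrite !gt_eqF.
  apply: (@le_trans _ _ N'); first by have := ler_norm N; rewrite /N'; lra.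
  rewrite -[X in _ <= X]mul1r ler_pdivlMr ?mulr_gt0//; lra.
apply: (le_trans N_le); rewrite /potential -(Int_cat _ 0 t1 (2 * T)) -(Int_cat _ t1 (t1 + r) (2 * T)).
have pos u v : u <= v -> 0 <= Int (fun t => (sqdist x y a b t)^-1) u v.
  move=> uv; rewrite -(mul0r (v - u)) -Int_cst//; apply: Int_le => //.
    exact: cont_cst.
  by move=> t _; rewrite invr_ge0 ltW.
have := pos _ _ t10; have : 0 <= Int (fun t => (sqdist x y a b t)^-1) (t1 + r) (2 * T).
  by apply: pos; lra.
have : Int (fun=> (k * r ^+ 2)^-1) t1 (t1 + r) <= Int (fun t => (sqdist x y a b t)^-1) t1 (t1 + r).
  apply: Int_le => //; [lra|exact: cont_cst|move=> s st].
  by rewrite lef_pV2 ?posrE ?Dle// mulr_gt0// exprn_gt0.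
by rewrite Int_cst; lra.
Qed.

End Potential.

(** * The generalized Dulac criterion *)

Section Pointwise.
Variables (R : realType) (T : topologicalType).
Implicit Types (f g : T -> R) (z : T).

Lemma ctD f g z : {for z, continuous f} -> {for z, continuous g} ->
  {for z, continuous (fun u => f u + g u)}.
Proof. exact: (@continuousD _ _ _ f g z). Qed.

Lemma ctM f g z : {for z, continuous f} -> {for z, continuous g} ->
  {for z, continuous (fun u => f u * g u)}.
Proof. exact: (@continuousM _ _ f g z). Qed.

Lemma ctMl (c : R) f z : {for z, continuous f} -> {for z, continuous (fun u => c * f u)}.
Proof. by apply: ctM; exact: cont_cst. Qed.

Lemma ctV f z : f z != 0 -> {for z, continuous f} -> {for z, continuous (fun u => (f u)^-1)}.
Proof. exact: (@continuousV _ _ f z). Qed.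

Lemma ct_comp (h : R -> R) f z : {for f z, continuous h} -> {for z, continuous f} ->
  {for z, continuous (fun u => h (f u))}.
Proof. by move=> ch cf; exact: (@continuous_comp _ _ _ f h z cf ch). Qed.

End Pointwise.

(** * Extension by zero *)

Section Glue.
Variable R : realType.
Local Notation der f t l := (is_derive t (1 : R) f l).
Implicit Types (D : R -> R -> Prop) (f : R -> R -> R) (a b : R).

(** The extension stays regular when, near each point outside [D], f is zero on all of [D], and not
    merely small; then no boundary behaviour has to be studied. *)
Definition on D f a b : R := if `[< D a b >] then f a b else 0.

Lemma onT D f a b : D a b -> on D f a b = f a b.
Proof. by move=> Dab; rewrite /on; case: asboolP. Qed.

Lemma onF D f a b : ~ D a b -> on D f a b = 0.
Proof. by move=> Dab; rewrite /on; case: asboolP. Qed.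

Lemma on_continuous D f a b :
  (D a b -> exists2 r, 0 < r & forall a' b', `|a' - a| <= r -> `|b' - b| <= r -> D a' b') ->
  (D a b -> {for (a, b), continuous (fun z : R * R => f z.1 z.2)}) ->
  (~ D a b -> exists2 r, 0 < r & forall a' b', `|a' - a| <= r -> `|b' - b| <= r ->
     D a' b' -> f a' b' = 0) ->
  {for (a, b), continuous (fun z : R * R => on D f z.1 z.2)}.
Proof.
move=> Dopen fcont Dedge.
have [Dab|Dab] := pselect (D a b).
  have [r r0 H] := Dopen Dab; have {}fcont := fcont Dab.
  rewrite /prop_for /continuous_at /= onT//; apply: cvg_trans fcont.
  apply: near_eq_cvg; have := near_box a b r0; apply: filterS => z [z1 z2].
  by rewrite onT//; exact: H.
have [r r0 H] := Dedge Dab.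
rewrite /prop_for /continuous_at /= onF//.
have c0 : (fun _ : R * R => 0 : R) @ (a, b) --> (0 : R) by exact: cvg_cst.
apply: cvg_trans c0; apply: near_eq_cvg; have := near_box a b r0; apply: filterS => z [z1 z2].
have [Dz|Dz] := pselect (D z.1 z.2); first by rewrite onT// H.
by rewrite onF.
Qed.

Lemma on_der D (f df : R -> R -> R) (u v : R -> R) t : continuous u -> continuous v ->
  (D (u t) (v t) -> exists2 r, 0 < r &
     forall a' b', `|a' - u t| <= r -> `|b' - v t| <= r -> D a' b') ->
  (D (u t) (v t) -> der (fun t => f (u t) (v t)) t (df (u t) (v t))) ->
  (~ D (u t) (v t) -> exists2 r, 0 < r &
     forall a' b', `|a' - u t| <= r -> `|b' - v t| <= r -> D a' b' -> f a' b' = 0) ->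
  der (fun t => on D f (u t) (v t)) t (on D df (u t) (v t)).
Proof.
move=> cu cv Dopen fder Dedge.
have near_uv r : 0 < r -> \forall s \near t, `|u s - u t| <= r /\ `|v s - v t| <= r.
  move=> r0; near=> s; split; rewrite distrC; near: s.
    by have /cvgrPdist_le := cu t; apply.
  by have /cvgrPdist_le := cv t; apply.
have [Dt|Dt] := pselect (D (u t) (v t)).
  have [r r0 H] := Dopen Dt; rewrite onT//; apply: der_near_eq (fder Dt).
  have := near_uv r r0; apply: filterS => s [h1 h2].
  by rewrite onT//; exact: H.
have [r r0 H] := Dedge Dt; rewrite onF//; apply: der_near_eq (der_cst 0 t).
have := near_uv r r0; apply: filterS => s [h1 h2].
have [Ds|Ds] := pselect (D (u s) (v s)); first by rewrite onT// H.
by rewrite onF.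
Unshelve. all: by end_near. Qed.

End Glue.

Section Dulac.
Variables (R : realType) (P Q : bipoly R) (v : {poly R}) (s : R).
Local Notation der f t l := (is_derive t (1 : R) f l).

(* The function M_s in cartesian coordinates, with w(r) = v(r^2). *)
Definition dulac (a b : R) : R :=
  2 * v^`().[a ^+ 2 + b ^+ 2] * (a * eval2 P a b + b * eval2 Q a b) +
  s * v.[a ^+ 2 + b ^+ 2] * (eval2 (mderiv ord0 P) a b + eval2 (mderiv ord_max Q) a b).

Lemma horner_der (p : {poly R}) (f : R -> R) t l : der f t l ->
  der (fun t => p.[f t]) t (p^`().[f t] * l).
Proof. move=> df; exact: (@der_comp R (horner p) f t _ _ (is_derive_poly p (f t)) df). Qed.

Variables (sg m M L : R) (D : R -> R -> Prop) (U Ua Ub : R -> R -> R).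
Hypotheses (s0 : s != 0) (m0 : 0 < m) (L0 : 0 <= L).
Hypothesis v_sign : forall r, m <= r <= M -> 0 < sg * v.[r].
Hypothesis dulac_lt0 : forall a b, 0 < a ^+ 2 + b ^+ 2 -> dulac a b < 0.
Hypothesis D_bounded : forall a b, D a b -> m <= a ^+ 2 + b ^+ 2 <= M.
Hypothesis D_open : forall a b, D a b -> exists2 r, 0 < r &
  forall a' b', `|a' - a| <= r -> `|b' - b| <= r -> D a' b'.
(** Covers both kinds of outside points: on an orbit U blows up, elsewhere a whole box misses
    [D]. *)
Hypothesis D_edge : forall a b N, ~ D a b -> exists2 r, 0 < r &
  forall a' b', `|a' - a| <= r -> `|b' - b| <= r -> D a' b' -> N <= U a' b'.
Hypothesis U_ge0 : forall a b, D a b -> 0 <= U a b.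
Hypothesis U_der : forall a b, D a b ->
  der (fun a' => U a' b) a (Ua a b) /\ der (fun b' => U a b') b (Ub a b).
Hypothesis U_continuous : forall a b, D a b ->
  [/\ {for (a, b), continuous (fun z : R * R => U z.1 z.2)},
      {for (a, b), continuous (fun z : R * R => Ua z.1 z.2)} &
      {for (a, b), continuous (fun z : R * R => Ub z.1 z.2)}].
Hypothesis U_flow : forall a b, D a b ->
  `|Ua a b * eval2 P a b + Ub a b * eval2 Q a b| <= L * U a b.

(* [F k] is the Dulac function |V|^(1/s) times a cutoff which vanishes where [U]
   is large, and whose derivative along the field is O(k). *)
Let V a b := v.[a ^+ 2 + b ^+ 2].
Let dV c a b := v^`().[a ^+ 2 + b ^+ 2] * (2 * c).
Let B a b := expR (s^-1 * ln (sg * V a b)).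
Let W k a b := 1 - k * ln (1 + U a b).
Let F k a b := pos2 (W k a b) * B a b.
Let dF k (u c a b : R) := 2 * Num.max 0 (W k a b) * (- k * ((1 + U a b)^-1 * u)) * B a b +
  pos2 (W k a b) * (B a b * (s^-1 * (dV c a b * (V a b)^-1))).

Let sgV a b : D a b -> 0 < sg * V a b. Proof. by move=> /D_bounded /v_sign. Qed.
Let V0 a b : D a b -> V a b != 0.
Proof. by move=> /sgV h; apply: contraTneq h => ->; rewrite mulr0 ltxx. Qed.
Let sg0 a b : D a b -> sg != 0.
Proof. by move=> /sgV h; apply: contraTneq h => ->; rewrite mul0r ltxx. Qed.
Let U1 a b : D a b -> 0 < 1 + U a b. Proof. by move=> /U_ge0 h; rewrite ltr_pwDl. Qed.

(** Stated along a curve so that the two coordinate directions, and hence both partial derivatives,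
    are instances. *)
Let F_der_along k (x y : R -> R) t c u : D (x t) (y t) ->
  der (fun t => x t ^+ 2 + y t ^+ 2) t (2 * c) ->
  der (fun t => U (x t) (y t)) t u ->
  der (fun t => F k (x t) (y t)) t (dF k u c (x t) (y t)).
Proof.
move=> Dt dr dU; have V_der := horner_der v dr.
have h1 := @der_comp R (@ln R) (fun t => sg * V (x t) (y t)) t _ _ (is_derive1_ln (sgV Dt)) (derMl sg V_der).
have dB := @der_comp R (@expR R) (fun t => s^-1 * ln (sg * V (x t) (y t))) t _ _ (is_derive_expR _) (derMl s^-1 h1).
have dU1 := derD (der_cst 1 t) dU.
have h2 := @der_comp R (@ln R) (fun t => 1 + U (x t) (y t)) t _ _ (is_derive1_ln (U1 Dt)) dU1.
have h3 := derB (der_cst 1 t) (derMl k h2).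
have h4 := @der_comp R (@pos2 R) (fun t => W k (x t) (y t)) t _ _ (pos2_der _) h3.
apply: der_eq (derM h4 dB) _.
rewrite /dF -/(W k (x t) (y t)) -/(B (x t) (y t)) -/(V (x t) (y t)) /dV; congr (_ + _).
  by rewrite sub0r add0r mulNr; ring.
by field; rewrite (sg0 Dt) (V0 Dt) s0.
Qed.

Let norm2_continuous : continuous (fun z : R * R => z.1 ^+ 2 + z.2 ^+ 2).
Proof.
have c1 : continuous (fun z : R * R => z.1) by move=> z; exact: cvg_fst.
have c2 : continuous (fun z : R * R => z.2) by move=> z; exact: cvg_snd.
exact: (contD (contM c1 c1) (contM c2 c2)).
Qed.

Let horner2_continuous (p : {poly R}) z :
  {for z, continuous (fun z : R * R => p.[z.1 ^+ 2 + z.2 ^+ 2])}.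
Proof.
exact: (@ct_comp R _ (horner p) _ z (@continuous_horner _ p _) (norm2_continuous (x := z))).
Qed.

Let ln_continuous (x : R) : 0 < x -> {for x, continuous (@ln R)}.
Proof. by move=> x0; exact: der_continuous (is_derive1_ln x0). Qed.

Let B_continuous a b : D a b -> {for (a, b), continuous (fun z : R * R => B z.1 z.2)}.
Proof.
move=> Dab; apply: (@ct_comp R _ (@expR R) (fun z : R * R => s^-1 * ln (sg * V z.1 z.2))).
  exact: der_continuous (is_derive_expR _).
apply: ctMl; apply: (@ct_comp R _ (@ln R) (fun z : R * R => sg * V z.1 z.2)).
  exact/ln_continuous/sgV.
by apply: ctMl; exact: horner2_continuous.
Qed.

Let lnU_continuous a b : D a b ->
  {for (a, b), continuous (fun z : R * R => ln (1 + U z.1 z.2))}.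
Proof.
move=> Dab; have [cU _ _] := U_continuous Dab.
apply: (@ct_comp R _ (@ln R) (fun z : R * R => 1 + U z.1 z.2)).
  exact/ln_continuous/U1.
by apply: ctD => //; exact: cont_cst.
Qed.

Let W_continuous k a b : D a b -> {for (a, b), continuous (fun z : R * R => W k z.1 z.2)}.
Proof.
move=> Dab.
have -> : (fun z : R * R => W k z.1 z.2) = fun z => 1 + - k * ln (1 + U z.1 z.2).
  by apply/funext => z; rewrite /W mulNr.
by apply: ctD; [exact: cont_cst|apply: ctMl; exact: lnU_continuous].
Qed.

Let F_continuous k a b : D a b -> {for (a, b), continuous (fun z : R * R => F k z.1 z.2)}.
Proof.
move=> Dab; apply: ctM; last exact: B_continuous.
apply: (@ct_comp R _ (@pos2 R) (fun z : R * R => W k z.1 z.2)); last exact: W_continuous.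
exact: der_continuous (pos2_der _).
Qed.

Let max0_continuous (x : R) : {for x, continuous (fun x : R => Num.max 0 x)}.
Proof. by apply: continuous_max; [exact: cst_continuous|exact: cvg_id]. Qed.

Let dF_continuous k (u c : R * R -> R) a b : D a b ->
  {for (a, b), continuous u} -> {for (a, b), continuous c} ->
  {for (a, b), continuous (fun z : R * R => dF k (u z) (c z) z.1 z.2)}.
Proof.
move=> Dab cu cc; have [cU _ _] := U_continuous Dab.
have cB := B_continuous Dab; have cW := W_continuous (k := k) Dab.
apply: ctD; last first.
  apply: ctM.
    apply: (@ct_comp R _ (@pos2 R) (fun z : R * R => W k z.1 z.2)) => //.
    exact: der_continuous (pos2_der _).
  apply: ctM => //; apply: ctMl; apply: ctM.
    apply: ctM; first exact: horner2_continuous.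
    exact: ctMl.
  by apply: ctV; [exact: V0|exact: horner2_continuous].
apply: ctM => //; apply: ctM.
  apply: ctMl.
  exact: (@ct_comp R _ (fun x : R => Num.max 0 x) (fun z : R * R => W k z.1 z.2)).
apply: ctMl; apply: ctM => //; apply: ctV; first exact/lt0r_neq0/U1.
by apply: ctD => //; exact: cont_cst.
Qed.

Let edge_vanish k a b : 0 < k -> ~ D a b -> exists2 r, 0 < r &
  forall a' b', `|a' - a| <= r -> `|b' - b| <= r -> D a' b' -> W k a' b' <= 0.
Proof.
(* Above this threshold k log(1 + U) >= 1. *)
move=> k0 /(D_edge (expR k^-1))[r r0 H]; exists r => // a' b' ha hb Dab.
have h := H _ _ ha hb Dab.
rewrite /W subr_le0 -ler_pdivrMl// mulr1 -[X in X <= _]expRK ler_ln ?posrE ?expR_gt0//.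
  by rewrite (le_trans h)// lerDr.
exact: U1.
Qed.

Let B_bounded a0 b0 : D a0 b0 -> exists2 b1, 0 <= b1 & forall a b, D a b -> B a b <= b1.
Proof.
move=> /D_bounded/andP[h1 h2]; have mM := le_trans h1 h2.
pose f r := expR (s^-1 * ln (sg * v.[r])).
have cf : {within `[m, M], continuous f}.
  apply: derivable_within_continuous => r; rewrite in_itv/= => /v_sign sv.
  have dv := derMl sg (horner_der v (der_id r)).
  have h := @der_comp R (@ln R) (fun r => sg * v.[r]) r _ _ (is_derive1_ln sv) dv.
  have [] // := @der_comp R (@expR R) (fun r => s^-1 * ln (sg * v.[r])) r _ _
    (is_derive_expR _) (derMl s^-1 h).
have [r _ H] := EVT_max mM cf; exists (f r); first exact: expR_ge0.
by move=> a b /D_bounded Dab; apply: H; rewrite in_itv.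
Qed.

Let D_lt a b : D a b -> `|a| < M + 1 /\ `|b| < M + 1.
Proof.
move=> /D_bounded/andP[h1 h2].
have lt (u : R) : 0 <= u -> u ^+ 2 <= M -> u < M + 1.
  by move=> u0 uM; have := sqr_ge0 (u - 1); nra.
have := sqr_ge0 a; have := sqr_ge0 b => *.
by split; apply: lt => //; rewrite real_normK ?num_real//; lra.
Qed.

(** Up to the sign [tau], the divergence of [B] X, where [B] is a constant multiple of |V|^(1/s):
    what remains where the cutoff equals 1. *)
Let J tau a b := B a b * (tau * (dulac a b * (s * V a b)^-1)).

Let J_gt0 tau a b : tau * tau = 1 -> tau * (s * sg) < 0 -> D a b -> 0 < J tau a b.
Proof.
move=> tau2 tausg Dab; rewrite mulr_gt0 ?expR_gt0//.
have /andP[h _] := D_bounded Dab.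
have dl := dulac_lt0 (lt_le_trans m0 h).
have sg2 : 0 < sg ^+ 2 by rewrite exprn_even_gt0//= (sg0 Dab).
have tq : tau * (s * V a b) < 0.
  rewrite -(pmulr_llt0 _ sg2).
  have -> : tau * (s * V a b) * sg ^+ 2 = tau * (s * sg) * (sg * V a b) by ring.
  by rewrite nmulr_rlt0// sgV.
have -> : tau * (dulac a b * (s * V a b)^-1) = dulac a b * (tau * (s * V a b))^-1.
  have t0 : tau != 0 by apply: contraTneq tq => ->; rewrite mul0r ltxx.
  rewrite [(tau * _)^-1]invfM (_ : tau^-1 = tau); first by ring.
  by apply: (mulfI t0); rewrite mulfV.
by rewrite nmulr_rgt0// invr_lt0.
Qed.

Let J_continuous tau a b : D a b -> {for (a, b), continuous (fun z : R * R => J tau z.1 z.2)}.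
Proof.
move=> Dab; apply: ctM; first exact: B_continuous.
have c1 : continuous (fun z : R * R => z.1) by move=> z; exact: cvg_fst.
have c2 : continuous (fun z : R * R => z.2) by move=> z; exact: cvg_snd.
have cP := @eval2_continuous R P; have cQ := @eval2_continuous R Q.
have cPx := @eval2_continuous R (mderiv ord0 P).
have cQy := @eval2_continuous R (mderiv ord_max Q).
apply: ctMl; apply: ctM.
  apply: ctD; apply: ctM.
  - by apply: ctMl; exact: horner2_continuous.
  - exact: (contD (contM c1 cP) (contM c2 cQ)).
  - by apply: ctMl; exact: horner2_continuous.
  - exact: (contD cPx cQy).
apply: ctV; first by rewrite mulf_neq0// V0.
by apply: ctMl; exact: horner2_continuous.
Qed.

Let W_le1 k a b : 0 <= k -> D a b -> 0 <= Num.max 0 (W k a b) <= 1.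
Proof.
move=> k0 Dab; rewrite le_max lexx /= ge_max ler01 /= /W lerBlDr lerDl.
by rewrite mulr_ge0// ln_ge0// lerDl U_ge0.
Qed.

Let G1 tau k a b := tau * (dF k (Ua a b) a a b * eval2 P a b + F k a b * eval2 (mderiv ord0 P) a b).
Let G2 tau k a b := tau * (dF k (Ub a b) b a b * eval2 Q a b + F k a b * eval2 (mderiv ord_max Q) a b).

Let GE tau k a b : D a b -> G1 tau k a b + G2 tau k a b =
  pos2 (W k a b) * J tau a b - tau * (B a b * (2 * (Num.max 0 (W k a b) * (k *
   ((1 + U a b)^-1 * (Ua a b * eval2 P a b + Ub a b * eval2 Q a b)))))).
Proof.
move=> Dab; have V1 := V0 Dab; have U1' := lt0r_neq0 (U1 Dab).
rewrite /G1 /G2 /J /dulac /F /dF /dV -/(V a b).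
by field; rewrite V1 U1' s0.
Qed.

(** The term from differentiating the cutoff. Dividing X.U by 1 + U, the effect of the logarithm,
    leaves at most [L], however large U is. *)
Let G_error tau k a b b1 : `|tau| = 1 -> 0 <= k -> D a b -> B a b <= b1 ->
  `|tau * (B a b * (2 * (Num.max 0 (W k a b) * (k *
   ((1 + U a b)^-1 * (Ua a b * eval2 P a b + Ub a b * eval2 Q a b))))))| <= 2 * k * L * b1.
Proof.
move=> tau1 k0 Dab Bb1; have /andP[w0 w1] := W_le1 k0 Dab.
have B0 : 0 <= B a b by exact: expR_ge0.
have u1 := U1 Dab; have i0 : 0 <= (1 + U a b)^-1 by rewrite invr_ge0 ltW.
rewrite !normrM tau1 mul1r (ger0_norm B0) (ger0_norm w0) (ger0_norm k0) (ger0_norm i0).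
rewrite (ger0_norm (ler0n R 2)).
have hX : (1 + U a b)^-1 * `|Ua a b * eval2 P a b + Ub a b * eval2 Q a b| <= L.
  rewrite mulrC ler_pdivrMr//; apply: (le_trans (U_flow Dab)).
  by rewrite mulrDr mulr1 lerDr.
have X0 : 0 <= (1 + U a b)^-1 * `|Ua a b * eval2 P a b + Ub a b * eval2 Q a b|.
  by rewrite mulr_ge0.
have -> : 2 * k * L * b1 = b1 * (2 * (1 * (k * L))) by ring.
apply: ler_pM => //; first by rewrite !mulr_ge0.
rewrite ler_pM2l//; apply: ler_pM => //; first by rewrite mulr_ge0.
exact: ler_wpM2l.
Qed.

Lemma dulac_empty a0 b0 : D a0 b0 -> False.
Proof.
move=> D0.
(* The signs of s and V are unknown; [tau] turns the divergence positive. *)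
have [tau [tau1 tau2 tausg]] : exists tau : R,
    [/\ `|tau| = 1, tau * tau = 1 & tau * (s * sg) < 0].
  have ssg : s * sg != 0 by rewrite mulf_neq0// (sg0 D0).
  have [h|h] := ltP (s * sg) 0; first by exists 1; rewrite normr1 !mul1r.
  exists (-1); rewrite normrN normr1 mulrNN mulr1 mulN1r oppr_lt0; split => //.
  by rewrite lt0r ssg.
have [b1 b10 Bb1] := B_bounded D0.
pose J0 := J tau a0 b0; have J00 : 0 < J0 by exact: J_gt0.
(* Bounds log(1 + U) on a box that does not depend on k; with k l0 <= 1/2 the cutoff there is at
   least 1/4. *)
pose l0 := ln (1 + U a0 b0) + 1.
have l00 : 0 < l0 by rewrite ltr_wpDl// ln_ge0// lerDl U_ge0.
have [r r0 Hr] : exists2 r, 0 < r & forall a b, `|a - a0| <= r -> `|b - b0| <= r ->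
    [/\ D a b, J0 / 2 < J tau a b & ln (1 + U a b) < l0].
  apply: near_boxP.
  have [r r0 H] := D_open D0.
  have n1 := near_box a0 b0 r0.
  have J2 : J0 / 2 < J tau (a0, b0).1 (a0, b0).2 by rewrite -/J0 /=; lra.
  have n2 := J_continuous (tau := tau) D0 (lt_nbhsr J2).
  have l1 : ln (1 + U (a0, b0).1 (a0, b0).2) < l0 by rewrite /l0 /= ltrDl.
  have n3 := lnU_continuous D0 (lt_nbhsl l1).
  near=> z; split.
  - have [h1 h2] : `|z.1 - a0| <= r /\ `|z.2 - b0| <= r by near: z.
    exact: H.
  - by near: z.
  - by near: z.
(* Strictly larger than every coordinate in [D], so the truncated field vanishes on the sides of the
   square. *)
pose K := M + 1.
have DK a b : D a b -> `|a| < K /\ `|b| < K by exact: D_lt.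
have K0 : 0 < K by have [h _] := DK _ _ D0; apply: le_lt_trans h.
(* The cutoff contributes 1/4 and the divergence J0 / 2. *)
have [c c0 cE] : exists2 c, 0 < c & c = J0 / 8 by exists (J0 / 8) => //; rewrite divr_gt0.
(* Twice the area of the square times the error constant 2 L b1; the summand 1 keeps [A] positive
   when that constant is 0. *)
pose A := 2 * (2 * L * b1 + 1) * (2 * K) * (2 * K).
have A0 : 0 < A.
  by rewrite !mulr_gt0// ltr_wpDl// !mulr_ge0.
pose k := Num.min (2 * l0)^-1 (c * (2 * r) * (2 * r) / A).
have k0 : 0 < k.
  rewrite lt_min; apply/andP; split.
    by rewrite invr_gt0 mulr_gt0.
  by rewrite divr_gt0// !mulr_gt0.
have kl : k * l0 <= 1 / 2.
  have : k <= (2 * l0)^-1 by rewrite ge_min lexx.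
  by rewrite -[X in _ <= X]mul1r ler_pdivlMr ?mulr_gt0//; lra.
have kA : k * A <= c * (2 * r) * (2 * r).
  have : k <= c * (2 * r) * (2 * r) / A by rewrite ge_min lexx orbT.
  by rewrite ler_pdivlMr.
have edge a b : ~ D a b -> exists2 r, 0 < r & forall a' b',
    `|a' - a| <= r -> `|b' - b| <= r -> D a' b' -> W k a' b' <= 0 by exact: edge_vanish.
have F0 a b : W k a b <= 0 -> F k a b = 0.
  by move=> w; rewrite /F /pos2 max_l// expr0n mul0r.
have dF0 u c' a b : W k a b <= 0 -> dF k u c' a b = 0.
  by move=> w; rewrite /dF /pos2 max_l// expr0n !mulr0 !mul0r addr0.
pose F1 := on D (fun a b => tau * (F k a b * eval2 P a b)).
pose F2 := on D (fun a b => tau * (F k a b * eval2 Q a b)).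
have F1_der a b : der (fun a' => F1 a' b) a (on D (G1 tau k) a b).
  apply: (@on_der R D _ (G1 tau k) (fun a => a) (fun=> b)).
  - by move=> z; exact: cvg_id.
  - exact: cont_cst.
  - exact: D_open.
  - move=> Dab; apply: derMl; have [dU _] := U_der Dab.
    have dr : der (fun a' => a' ^+ 2 + b ^+ 2) a (2 * a).
      by apply: der_eq (derD (der_sqr (der_id a)) (der_cst (b ^+ 2) a)) _; ring.
    have dFk := @F_der_along k (fun a => a) (fun=> b) a a _ Dab dr dU.
    apply: der_eq (derM dFk (eval2_der P (der_id a) (der_cst b a))) _; ring.
  - move=> /edge[q q0 H]; exists q => // a' b' ha hb Dab.
    by rewrite F0 ?H// mul0r mulr0.
have F2_der a b : der (fun b' => F2 a b') b (on D (G2 tau k) a b).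
  apply: (@on_der R D _ (G2 tau k) (fun=> a) (fun b => b)).
  - exact: cont_cst.
  - by move=> z; exact: cvg_id.
  - exact: D_open.
  - move=> Dab; apply: derMl; have [_ dU] := U_der Dab.
    have dr : der (fun b' => a ^+ 2 + b' ^+ 2) b (2 * b).
      by apply: der_eq (derD (der_cst (a ^+ 2) b) (der_sqr (der_id b))) _; ring.
    have dFk := @F_der_along k (fun=> a) (fun b => b) b b _ Dab dr dU.
    apply: der_eq (derM dFk (eval2_der Q (der_cst a b) (der_id b))) _; ring.
  - move=> /edge[q q0 H]; exists q => // a' b' ha hb Dab.
    by rewrite F0 ?H// mul0r mulr0.
have cF1 : continuous (fun z : R * R => F1 z.1 z.2).
  move=> [a b]; apply: on_continuous; first exact: D_open.
    move=> Dab; apply: ctMl; apply: ctM; first exact: F_continuous.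
    exact: eval2_continuous.
  move=> /edge[q q0 H]; exists q => // a' b' ha hb Dab.
  by rewrite F0 ?H// mul0r mulr0.
have cG1 : continuous (fun z : R * R => on D (G1 tau k) z.1 z.2).
  move=> [a b]; apply: on_continuous; first exact: D_open.
    move=> Dab; have [_ cUa _] := U_continuous Dab.
    apply: ctMl; apply: ctD; apply: ctM; try exact: eval2_continuous.
      exact: (dF_continuous (u := fun z => Ua z.1 z.2) (c := fst) Dab cUa cvg_fst).
    exact: F_continuous.
  move=> /edge[q q0 H]; exists q => // a' b' ha hb Dab.
  by rewrite /G1 F0 ?dF0 ?H// !mul0r addr0 mulr0.
have cG2 : continuous (fun z : R * R => on D (G2 tau k) z.1 z.2).
  move=> [a b]; apply: on_continuous; first exact: D_open.
    move=> Dab; have [_ _ cUb] := U_continuous Dab.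
    apply: ctMl; apply: ctD; apply: ctM; try exact: eval2_continuous.
      exact: (dF_continuous (u := fun z => Ub z.1 z.2) (c := snd) Dab cUb cvg_snd).
    exact: F_continuous.
  move=> /edge[q q0 H]; exists q => // a' b' ha hb Dab.
  by rewrite /G2 F0 ?dF0 ?H// !mul0r addr0 mulr0.
have out a b : K <= `|a| \/ K <= `|b| -> ~ D a b.
  by move=> h /DK[h1 h2]; case: h; rewrite leNgt ?h1 ?h2.
have nK : K <= `|K| by rewrite ger0_norm// ltW.
have nNK : K <= `|- K| by rewrite normrN.
have inK a b : `|a - a0| <= r -> `|b - b0| <= r -> `|a| < K /\ `|b| < K.
  by move=> ha hb; have [/DK] := Hr _ _ ha hb.
have rr1 : `|a0 + r - a0| <= r by rewrite addrAC subrr add0r ger0_norm// ltW.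
have rr2 : `|a0 - r - a0| <= r by rewrite addrAC subrr add0r normrN ger0_norm// ltW.
have rr3 : `|b0 + r - b0| <= r by rewrite addrAC subrr add0r ger0_norm// ltW.
have rr4 : `|b0 - r - b0| <= r by rewrite addrAC subrr add0r normrN ger0_norm// ltW.
have [/ltr_normlP[_ i1] /ltr_normlP[_ i2]] := inK _ _ rr1 rr3.
have [/ltr_normlP[i3 _] /ltr_normlP[i4 _]] := inK _ _ rr2 rr4.
pose e := 2 * k * L * b1.
have e0 : 0 <= e by rewrite !mulr_ge0// ltW.
have pos2_ge0 x : 0 <= @pos2 R x by rewrite /pos2 sqr_ge0.
have lo a b : - e <= on D (G1 tau k) a b + on D (G2 tau k) a b.
  have [Dab|Dab] := pselect (D a b); last by rewrite !onF// addr0 oppr_le0.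
  rewrite !onT// GE//.
  have := G_error tau1 (ltW k0) Dab (Bb1 _ _ Dab); rewrite ler_norml => /andP[_ h].
  have := mulr_ge0 (pos2_ge0 (W k a b)) (ltW (J_gt0 tau2 tausg Dab)).
  by rewrite -/e in h *; lra.
have lor a b : `|a - a0| <= r -> `|b - b0| <= r ->
    c - e <= on D (G1 tau k) a b + on D (G2 tau k) a b.
  move=> ha hb; have [Dab Jab lab] := Hr _ _ ha hb.
  rewrite !onT// GE//.
  have := G_error tau1 (ltW k0) Dab (Bb1 _ _ Dab); rewrite ler_norml => /andP[_ h].
  have w2 : 1 / 2 <= W k a b.
    have : k * ln (1 + U a b) <= k * l0 by rewrite ler_pM2l// ltW.
    by rewrite /W; lra.
  have : 1 / 4 <= pos2 (W k a b) by exact: pos2_ge_quarter.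
  move=> w4; have : 1 / 4 * (J0 / 2) <= pos2 (W k a b) * J tau a b.
    by apply: ler_pM => //; try exact: ltW; lra.
  by rewrite -/e in h *; lra.
have := @divergence_lower R F1 F2 (on D (G1 tau k)) (on D (G2 tau k)) K r a0 b0 c e
  F1_der F2_der _ cG1 cG2 _ _ (ltW r0) _ _ _ _ lo lor.
have h1 x : continuous (F1 x).
  move=> z.
  exact: (@continuous_comp _ _ _ (fun z : R => (x, z)) (fun p : R * R => F1 p.1 p.2) z
    (cvg_pair (F := nbhs z) (f := fun=> x) (g := id) (cvg_cst x) cvg_id) (cF1 (x, z))).
have h2 z : F1 (- K) z = 0 /\ F1 K z = 0.
  by split; apply: onF; apply: out; left.
have h3 z : F2 z (- K) = 0 /\ F2 z K = 0.
  by split; apply: onF; apply: out; right.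
move=> /(_ h1 h2 h3) H.
have {}H : c * (2 * r) * (2 * r) <= e * (2 * K) * (2 * K).
  by apply: H; rewrite 1?lerNl; exact: ltW.
have : k * (2 * (2 * L * b1 + 1) * (2 * K) * (2 * K)) =
  2 * (e * (2 * K) * (2 * K)) + 2 * k * (2 * K) * (2 * K) by rewrite /e; ring.
have p1 : 0 < k * (2 * K) * (2 * K) by rewrite !mulr_gt0.
have p2 : 0 < c * (2 * r) * (2 * r) by rewrite !mulr_gt0.
have p3 : 0 <= e * (2 * K) * (2 * K) by rewrite !mulr_ge0// ltW.
by move: kA; rewrite /A => kA E; lra.
Unshelve. all: by end_near. Qed.

End Dulac.

(** * Hyperbolicity, and uniqueness in an annulus *)

Section Annulus.
Variables (R : realType) (P Q : bipoly R) (v : {poly R}) (s : R).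
Local Notation der f t l := (is_derive t (1 : R) f l).
Hypothesis dulac_lt0 : forall a b, 0 < a ^+ 2 + b ^+ 2 -> dulac P Q v s a b < 0.
Hypotheses (P00 : eval2 P 0 0 = 0) (Q00 : eval2 Q 0 0 = 0).

Let div (a b : R) : R := eval2 (divergence P Q) a b.

Lemma norm2_orbit_gt0 x y T t : periodic_solution P Q x y T -> 0 < x t ^+ 2 + y t ^+ 2.
Proof.
move=> per; rewrite lt0r addr_ge0 ?sqr_ge0// andbT paddr_eq0 ?sqr_ge0// !sqrf_eq0.
apply/negP => /andP[/eqP xt /eqP yt].
by have := velocity_gt0 per t; rewrite xt yt P00 Q00 expr0n addr0 ltxx.
Qed.

Lemma norm2_der x y T t : periodic_solution P Q x y T ->
  der (fun t => x t ^+ 2 + y t ^+ 2) t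
    (2 * x t * eval2 P (x t) (y t) + 2 * y t * eval2 Q (x t) (y t)).
Proof.
move=> per; have [dx dy] := periodic_sol per t.
by apply: derD; exact: der_sqr.
Qed.

(* Along a periodic orbit V exp(s int div) decreases strictly, since its
   derivative is M exp(s int div); over one period only the exponential factor
   can change. *)
Lemma periodic_orbit_monotone x y T t : periodic_solution P Q x y T ->
  v.[x t ^+ 2 + y t ^+ 2] != 0 /\ s * Int (fun t => div (x t) (y t)) t (t + T) != 0.
Proof.
move=> per; have T0 := period_gt0 per.
pose I := prim (fun t => div (x t) (y t)).
have dI z : der I z (div (x z) (y z)).
  exact: (primP _ (eval2_sol_continuous (F := divergence P Q) per)).
pose V z := v.[x z ^+ 2 + y z ^+ 2].
have dE z := @der_comp R (@expR R) (fun z => s * I z) z _ _ (is_derive_expR _) (derMl s (dI z)).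
have dV z := horner_der v (norm2_der z per).
have dh z : der (fun z => - (V z * expR (s * I z))) z
    (- dulac P Q v s (x z) (y z) * expR (s * I z)).
  apply: der_eq (derN (derM (dV z) (dE z))) _.
  by rewrite /dulac /div /divergence eval2D; ring.
have := @der_gt0 R _ _ t (t + T) _ (fun z _ => dh z) _.
rewrite ltrDl => /(_ T0) H.
have {}H : - (V t * expR (s * I t)) < - (V (t + T) * expR (s * I (t + T))).
  by apply: H => z _; rewrite mulr_gt0 ?expR_gt0// oppr_gt0 dulac_lt0// (norm2_orbit_gt0 _ per).
have VT : V (t + T) = V t by rewrite /V; have [-> ->] := periodicE per t.
rewrite VT ltrN2 in H.
split; apply/eqP => E0; move: H.
  by rewrite /V E0 !mul0r ltxx.
have -> : I (t + T) = I t + Int (fun t => div (x t) (y t)) t (t + T) by rewrite /Int [RHS]addrC subrK.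
by rewrite mulrDr E0 addr0 ltxx.
Qed.

Lemma periodic_orbit_hyperbolic g : hyperbolic P Q g.
Proof.
move=> x y T per _; have T0 := period_gt0 per.
pose f t := div (x t) (y t).
have cf : continuous f by exact: (eval2_sol_continuous per).
have dF t := primP t cf.
have cF : continuous (prim f) by move=> t; exact: der_continuous (dF t).
have -> : \int[lebesgue_measure]_(t in `[0, T]) eval2 (divergence P Q) (x t) (y t) =
    Int f 0 T.
  rewrite /Rintegral (@continuous_FTC2 R f (prim f) 0 T T0) //.
  - exact: continuous_subspaceT.
  - split.
    + by move=> t _; have [] := dF t.
    + by apply: cvg_at_right_filter; exact: cF.
    + by apply: cvg_at_left_filter; exact: cF.
  - by move=> t _; rewrite derive1E; have [_ ->] := dF t.
have [_] := periodic_orbit_monotone 0 per; rewrite add0r.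
by apply: contraNneq => ->; rewrite mulr0.
Qed.

Lemma annulus_unique x1 y1 T1 x2 y2 T2 (sg m M : R) :
  periodic_solution P Q x1 y1 T1 -> periodic_solution P Q x2 y2 T2 -> 0 < m ->
  (forall t, m <= x1 t ^+ 2 + y1 t ^+ 2 <= M) ->
  (forall t, m <= x2 t ^+ 2 + y2 t ^+ 2 <= M) ->
  (forall r, m <= r <= M -> 0 < sg * v.[r]) ->
  orbit_of x1 y1 = orbit_of x2 y2.
Proof.
move=> per1 per2 m0 H1 H2 sgv.
(* The exponent 1/s needs this. It follows from the mere existence of a periodic orbit, as s times
   the integral of the divergence is nonzero. *)
have s0 : s != 0.
  by have [_] := periodic_orbit_monotone 0 per1; apply: contraNneq => ->; rewrite mul0r.
apply: contrapT => neq.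
have disj t t' : (x1 t, y1 t) <> (x2 t', y2 t').
  by move=> E; apply: neq; exact: periodic_orbit_meet per1 per2 E.
have [D [[a0 [b0 D0]] Doff Dloc Dbd]] := separation per1 per2 disj m0 H1 H2.
pose K := M + 1.
have bdK (a b : R) : m <= a ^+ 2 + b ^+ 2 <= M -> `|a| <= K /\ `|b| <= K.
  move=> /andP[h1 h2].
  have le (u : R) : 0 <= u -> u ^+ 2 <= M -> u <= M + 1.
    by move=> u0 uM; have := sqr_ge0 (u - 1); nra.
  have := sqr_ge0 a; have := sqr_ge0 b => *.
  by split; apply: le => //; rewrite real_normK ?num_real//; lra.
have [L L0 HL] := field_lipschitz P Q K.
pose p1 := potential x1 y1 T1; pose p2 := potential x2 y2 T2.
have avoidsN x y (a b : R) : ~ avoids x y a b -> exists t, a = x t /\ b = y t.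
  move=> /existsNP[t /negP]; rewrite -leNgt => h; exists t.
  have /eqP : sqdist x y a b t = 0.
    by apply/eqP; rewrite eq_le h addr_ge0 ?sqr_ge0.
  rewrite paddr_eq0 ?sqr_ge0// !sqrf_eq0 !subr_eq0.
  by move=> /andP[/eqP -> /eqP ->].
(* By [potential_flow], each of the two potentials has flow derivative at most 2 L times itself,
   hence so has their sum. *)
apply: (@dulac_empty R P Q v s sg m M (2 * L) D (fun a b => p1 a b + p2 a b)
  (fun a b => dpotential x1 y1 T1 x1 a a b + dpotential x2 y2 T2 x2 a a b)
  (fun a b => dpotential x1 y1 T1 y1 b a b + dpotential x2 y2 T2 y2 b a b)
  s0 m0 _ sgv dulac_lt0 Dbd _ _ _ _ _ _ a0 b0 D0).
- by rewrite mulr_ge0.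
- move=> a b Dab; have [off1 off2] := Doff _ _ Dab.
  have [r r0 H] := Dloc _ _ off1 off2; exists r => // a' b' ha hb.
  by apply/(H _ _ ha hb).
- move=> a b N nD.
  have [off1|/avoidsN[t [-> ->]]] := pselect (avoids x1 y1 a b); last first.
    have [r r0 H] := potential_blowup per1 t N; exists r => // a' b' ha hb /Doff[h1 h2].
    have := H _ _ ha hb h1; have := potential_ge0 per2 h2; rewrite /p1 /p2; lra.
  have [off2|/avoidsN[t [-> ->]]] := pselect (avoids x2 y2 a b); last first.
    have [r r0 H] := potential_blowup per2 t N; exists r => // a' b' ha hb /Doff[h1 h2].
    have := H _ _ ha hb h2; have := potential_ge0 per1 h1; rewrite /p1 /p2; lra.
  have [r r0 H] := Dloc _ _ off1 off2; exists r => // a' b' ha hb Dab.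
  by case: nD; apply/(H _ _ ha hb).
- move=> a b /Doff[h1 h2].
  exact: addr_ge0 (potential_ge0 per1 h1) (potential_ge0 per2 h2).
- move=> a b /Doff[h1 h2].
  have [d1 d2] := potential_der per1 h1; have [d3 d4] := potential_der per2 h2.
  by split; apply: derD.
- move=> a b /Doff[h1 h2].
  have [c1 c2] := dpotential_continuous per1 h1.
  have [c3 c4] := dpotential_continuous per2 h2.
  have c5 := potential_continuous per1 h1; have c6 := potential_continuous per2 h2.
  by split; apply: ctD.
- move=> a b Dab; have [h1 h2] := Doff _ _ Dab; have [aK bK] := bdK _ _ (Dbd _ _ Dab).
  have f1 := potential_flow per1 h1 aK bK (fun t => bdK _ _ (H1 t)) HL.
  have f2 := potential_flow per2 h2 aK bK (fun t => bdK _ _ (H2 t)) HL.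
  rewrite mulrDr; apply: le_trans (lerD f1 f2).
  by apply: le_trans (ler_normD _ _); rewrite le_eqVlt; apply/orP; left; apply/eqP; congr `|_|; ring.
Qed.

Lemma orbit_norm2_range x y T : periodic_solution P Q x y T ->
  exists t0 t1, forall t, x t0 ^+ 2 + y t0 ^+ 2 <= x t ^+ 2 + y t ^+ 2 <= x t1 ^+ 2 + y t1 ^+ 2.
Proof.
move=> per; have T0 := period_gt0 per.
have cn : continuous (fun t => x t ^+ 2 + y t ^+ 2).
  by move=> t; exact: der_continuous (norm2_der t per).
have pn t : x (t + T) ^+ 2 + y (t + T) ^+ 2 = x t ^+ 2 + y t ^+ 2.
  by have [-> ->] := periodicE per t.
have [t0 h0] := periodic_min T0 cn pn.
have [|t1 h1] := @periodic_min R (fun t => -1 * (x t ^+ 2 + y t ^+ 2)) T T0 (contMl cn).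
  by move=> t; rewrite pn.
by exists t0, t1 => t; have := h0 t; have := h1 t; lra.
Qed.

(** Otherwise the squared radius would take the value r on the orbit, where V has no zero. *)
Lemma orbit_between_roots x y T (r : R) t t' : periodic_solution P Q x y T -> v.[r] = 0 ->
  r < x t ^+ 2 + y t ^+ 2 -> r < x t' ^+ 2 + y t' ^+ 2.
Proof.
move=> per vr rt; rewrite ltNge; apply/negP => rt'.
pose n t := x t ^+ 2 + y t ^+ 2.
have cn : continuous n by move=> u; exact: der_continuous (norm2_der u per).
have [u nu] : exists u, n u = r.
  have [tt'|/ltW tt'] := leP t t'.
    have [|u _ <-] := @IVT R n t t' r tt' (continuous_subspaceT cn); last by exists u.
    by rewrite ge_min le_max rt' orbT /= (ltW rt).
  have [|u _ <-] := @IVT R n t' t r tt' (continuous_subspaceT cn); last by exists u.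
  by rewrite ge_min le_max rt' /= (ltW rt) orbT.
by have [/eqP nz _] := periodic_orbit_monotone u per; apply: nz; rewrite -/(n u) nu.
Qed.

(** The value [p.[m]] itself serves as the sign, which is why [sg] in the Dulac criterion is not
    normalized. *)
Lemma horner_const_sign (p : {poly R}) (m M : R) : (forall r, m <= r <= M -> p.[r] != 0) ->
  forall r, m <= r <= M -> 0 < p.[m] * p.[r].
Proof.
move=> H r /andP[mr rM].
have pm : p.[m] != 0 by apply: H; rewrite lexx (le_trans mr).
have pr : p.[r] != 0 by apply: H; rewrite mr.
rewrite lt0r mulf_neq0//= leNgt; apply/negP => neg.
have [|u] := @IVT R (horner p) m r 0 mr
    (continuous_subspaceT (@continuous_horner R p)).
  by rewrite ge_min le_max; move: neg; case: (ltP p.[m] 0) => h1 h2;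
     rewrite ?(ltW h1) ?h1/=; nra.
by rewrite in_itv/= => /andP[u1 u2] /eqP; apply/negP/H; rewrite u1 (le_trans u2).
Qed.

(** Let [m, M] span the squared radii of both orbits. A root in it would be below the maximum of one
    orbit, hence below all of that orbit, hence below all of the other, which contradicts m <= r. *)
Lemma same_roots_unique x1 y1 T1 x2 y2 T2 :
  periodic_solution P Q x1 y1 T1 -> periodic_solution P Q x2 y2 T2 ->
  (forall r, 0 <= r -> v.[r] = 0 ->
    (r < x1 0 ^+ 2 + y1 0 ^+ 2 <-> r < x2 0 ^+ 2 + y2 0 ^+ 2)) ->
  orbit_of x1 y1 = orbit_of x2 y2.
Proof.
move=> per1 per2 same.
have [t1 [t1' h1]] := orbit_norm2_range per1; have [t2 [t2' h2]] := orbit_norm2_range per2.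
pose n1 t := x1 t ^+ 2 + y1 t ^+ 2; pose n2 t := x2 t ^+ 2 + y2 t ^+ 2.
pose m := Num.min (n1 t1) (n2 t2); pose M := Num.max (n1 t1') (n2 t2').
have b1 t : m <= n1 t <= M.
  by have /andP[u1 u2] := h1 t; rewrite ge_min u1 le_max u2.
have b2 t : m <= n2 t <= M.
  by have /andP[u1 u2] := h2 t; rewrite ge_min u1 le_max u2 !orbT.
have m0 : 0 < m.
  by rewrite lt_min (norm2_orbit_gt0 _ per1) (norm2_orbit_gt0 _ per2).
apply: (annulus_unique per1 per2 m0 b1 b2 (horner_const_sign (p := v) _)) => r /andP[mr rM].
apply/eqP => vr.
have r0 : 0 <= r by rewrite (le_trans (ltW m0)).
have up : r < n1 t1' \/ r < n2 t2'.
  move: rM; rewrite le_max => /orP[h|h]; [left|right]; rewrite lt_neqAle h andbT;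
    apply/eqP => E.
    by have [/eqP nz _] := periodic_orbit_monotone t1' per1; apply: nz; rewrite -/(n1 t1') -E.
  by have [/eqP nz _] := periodic_orbit_monotone t2' per2; apply: nz; rewrite -/(n2 t2') -E.
have lt1 : r < n1 0.
  case: up => h; first exact: orbit_between_roots per1 vr h.
  by apply/(same r r0 vr); exact: orbit_between_roots per2 vr h.
have lt2 : r < n2 0 by apply/(same r r0 vr).
have l1 : r < n1 t1 by exact: orbit_between_roots per1 vr lt1.
have l2 : r < n2 t2 by exact: orbit_between_roots per2 vr lt2.
by move: mr; rewrite leNgt lt_min l1 l2.
Qed.

End Annulus.

(** * Polar coordinates and roots *)

Section Polar.
Variables (R : realType) (P Q : bipoly R) (p : {poly R}) (s : R).
Local Notation der f t l := (is_derive t (1 : R) f l).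

(* [w_poly p] as a polynomial in r^2. *)
Definition wv : {poly R} := 'X * p^`().

Lemma w_polyE (r : R) : (w_poly p).[r] = wv.[r ^+ 2].
Proof. by rewrite /w_poly /wv !hornerE horner_comp !hornerE. Qed.

Lemma deriv_w_polyE (r : R) : (w_poly p)^`().[r] = 2 * r * wv^`().[r ^+ 2].
Proof.
have d1 : der (fun r => (w_poly p).[r]) r (w_poly p)^`().[r] by exact: is_derive_poly.
have d2 := horner_der wv (der_sqr (der_id r)).
have [_ <-] := d1; under eq_fun do rewrite w_polyE.
by have [_ ->] := d2; ring.
Qed.

(** The bracket multiplied by s is the divergence in polar coordinates, and R w' is the derivative
    of V along the field. *)
Lemma M_fun_dulac (r th : R) : 0 < r ->
  M_fun P Q (w_poly p) s r th = dulac P Q wv s (r * cos th) (r * sin th).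
Proof.
move=> r0; pose c := cos th; pose si := sin th.
have cs : c ^+ 2 + si ^+ 2 = 1 by rewrite cos2Dsin2.
have dr1 : der (fun r => r * c) r c.
  by apply: der_eq (derM (der_id r) (der_cst c r)) _; ring.
have dr2 : der (fun r => r * si) r si.
  by apply: der_eq (derM (der_id r) (der_cst si r)) _; ring.
have dt1 : der (fun t => r * cos t) th (- (r * si)).
  by apply: der_eq (derMl r (is_derive_cos th)) _; rewrite mulrN.
have dt2 : der (fun t => r * sin t) th (r * c) by apply: derMl; exact: is_derive_sin.
pose p0 := eval2 P (r * c) (r * si); pose q0 := eval2 Q (r * c) (r * si).
pose px := eval2 (mderiv ord0 P) (r * c) (r * si).
pose py := eval2 (mderiv ord_max P) (r * c) (r * si).
pose qx := eval2 (mderiv ord0 Q) (r * c) (r * si).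
pose qy := eval2 (mderiv ord_max Q) (r * c) (r * si).
have dR : der (fun r' => polar_R P Q r' th) r
    ((px * c + py * si) * c + (qx * c + qy * si) * si).
  apply: der_eq (derD (derM (eval2_der P dr1 dr2) (der_cst c r))
    (derM (eval2_der Q dr1 dr2) (der_cst si r))) _.
  by rewrite -/px -/py -/qx -/qy; ring.
have dT : der (fun th' => polar_Theta P Q r th') th
    (r^-1 * ((- qx * (r * si) + qy * (r * c)) * c - q0 * si -
             ((- px * (r * si) + py * (r * c)) * si + p0 * c))).
  apply: der_eq (derMl r^-1 (derB (derM (eval2_der Q dt1 dt2) (is_derive_cos th))
    (derM (eval2_der P dt1 dt2) (is_derive_sin th)))) _.
  by rewrite -/c -/si -/px -/py -/qx -/qy -/p0 -/q0; ring.
rewrite /M_fun w_polyE deriv_w_polyE !derive1E.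
have [_ ->] := dR; have [_ ->] := dT.
rewrite /polar_R -/c -/si /dulac -/px -/py -/qx -/qy -/p0 -/q0.
have -> : (r * c) ^+ 2 + (r * si) ^+ 2 = r ^+ 2.
  by rewrite !exprMn -mulrDr cs mulr1.
have s2 : si ^+ 2 = 1 - c ^+ 2 by rewrite -cs; ring.
have -> : (px * c + py * si) * c + (qx * c + qy * si) * si +
    r^-1 * ((- qx * (r * si) + qy * (r * c)) * c - q0 * si -
             ((- px * (r * si) + py * (r * c)) * si + p0 * c)) +
    (p0 * c + q0 * si) / r = (px + qy) * (c ^+ 2 + si ^+ 2).
  by field; exact: lt0r_neq0.
by rewrite cs; ring.
Qed.

Lemma polar_coordinates (a b : R) : 0 < a ^+ 2 + b ^+ 2 ->
  exists r th, [/\ 0 < r, 0 <= th <= 2 * pi, a = r * cos th & b = r * sin th].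
Proof.
move=> n0; pose r := Num.sqrt (a ^+ 2 + b ^+ 2).
have r0 : 0 < r by rewrite sqrtr_gt0.
have r2 : r ^+ 2 = a ^+ 2 + b ^+ 2 by rewrite sqr_sqrtr// ltW.
have x1 : -1 <= a / r <= 1.
  rewrite ler_pdivlMr// ler_pdivrMr// mulN1r mul1r -ler_norml.
  by rewrite -(ler_pXn2r (n := 2)) ?nnegrE ?(ltW r0)// real_normK ?num_real// r2 lerDl sqr_ge0.
have ca : cos (acos (a / r)) = a / r by rewrite acosK.
have sa : sin (acos (a / r)) = `|b| / r.
  rewrite sin_acos// (_ : 1 - _ = (b / r) ^+ 2); first by rewrite sqrtr_sqr normrM normfV (gtr0_norm r0).
  have b2 : b ^+ 2 = r ^+ 2 - a ^+ 2 by rewrite r2; ring.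
  by rewrite !expr_div_n b2; field; exact: lt0r_neq0.
have pi0 := pi_gt0 R.
have th0 := acos_ge0 x1; have thpi := acos_lepi x1.
have [b0|b0] := leP 0 b.
  exists r, (acos (a / r)); split => //; first by apply/andP; split; lra.
  - by rewrite ca mulrC divfK// gt_eqF.
  - by rewrite sa ger0_norm// mulrC divfK// gt_eqF.
exists r, (- acos (a / r) + pi *+ 2); split => //.
- by rewrite -mulr_natl; apply/andP; split; lra.
- by rewrite cosD2pi cosN ca mulrC divfK// gt_eqF.
- by rewrite sinD2pi sinN sa ltr0_norm// mulNr opprK mulrC divfK// gt_eqF.
Qed.

End Polar.

Lemma finite_roots (R : realType) (q : {poly R}) : q != 0 -> finite_set [set r : R | root q r].
Proof.
have [n] := ubnP (size q); elim: n q => // n IH q.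
have [[a ra]|nr] := pselect (exists a, root q a); last first.
  move=> _ _; rewrite (_ : [set _ | _] = set0) ?finite_set0//.
  by apply/seteqP; split => // a ra; apply: nr; exists a.
have /factor_theorem[q' ->] := ra => sq q0.
have q'0 : q' != 0 by apply: contraNneq q0 => ->; rewrite mul0r.
apply: (@sub_finite_set _ _ ([set a] `|` [set r | root q' r])).
  move=> r /=; rewrite rootM root_XsubC => /orP[rq|/eqP ->]; [by right|by left].
rewrite finite_setU; split; first exact: finite_set1.
by apply: IH => //; move: sq; rewrite size_Mmonic ?monicXsubC// size_XsubC addn2.
Qed.

(** Lets the number of roots below an orbit determine which roots they are. *)
Lemma count_subset_eq (T : eqType) (a b : pred T) (l : seq T) :
  (forall z, a z -> b z) -> count a l = count b l -> {in l, forall z, b z -> a z}.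
Proof.
move=> ab; elim: l => // z l IH /= E.
have le : (count a l <= count b l)%N by exact: sub_count.
have ab1 : (a z <= b z)%N by case: (a z) (ab z) => // ->.
have E1 : a z = b z :> nat by lia.
have E2 : count a l = count b l by lia.
move=> u; rewrite inE => /orP[/eqP -> bz|]; last exact: IH.
by move: E1; rewrite bz; case: (a z).
Qed.

(** * Counting the limit cycles *)

Unset Implicit Arguments.
Set Strict Implicit.
Set Printing Implicit Defensive.

Theorem theorem1 (R : realType) (n : nat) (P Q : bipoly R)
  (degPQ : system_degree P Q n)
  (P00 : eval2 P 0 0 = 0) (Q00 : eval2 Q 0 0 = 0)
  (p : {poly R}) (p_avg : averaged_poly P Q p)
  (s : R)
  (m : nat -> R -> R)
  (m_exp : M_expansion P Q (w_poly p) s (n + degree (w_poly p) - 1) m)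
  (mu : nat -> R)
  (m_le_mu : forall (i : nat) (th : R),
     (1 <= i <= n + degree (w_poly p) - 1)%N -> 0 <= th <= 2 * pi ->
     m i th <= mu i)
  (Phi_lt0 : forall r : R, 0 < r ->
     (Phi_poly (n + degree (w_poly p) - 1) mu).[r] < 0) :
  ([set g | limit_cycle P Q g] #<= `I_(nb_nneg_roots (w_poly p)))%card /\
  (forall g : set (R * R), limit_cycle P Q g -> hyperbolic P Q g).
Proof.
set w := w_poly p in m_exp m_le_mu Phi_lt0 *.
pose v := wv p.
have dulac_lt0 a b : 0 < a ^+ 2 + b ^+ 2 -> dulac P Q v s a b < 0.
  move=> /polar_coordinates[r [th [r0 th2 -> ->]]].
  rewrite -M_fun_dulac// m_exp//; apply: le_lt_trans (Phi_lt0 r r0).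
  rewrite /Phi_poly horner_sum !big_nat; apply: ler_sum => i iN.
  by rewrite hornerZ hornerXn ler_wpM2r ?exprn_ge0 ?(ltW r0)// m_le_mu.
split; last by move=> g _; exact: (@periodic_orbit_hyperbolic R P Q v s).
(* For w = 0 the number of roots takes its default value 0; but then M would vanish at (1, 0). *)
have w0 : w != 0.
  apply/eqP => w0; have := dulac_lt0 1 0; rewrite expr0n addr0 expr1n => /(_ ltr01).
  have v1 : v.[1] = 0 by have := w_polyE p 1; rewrite -/w w0 horner0 expr1n.
  have dv1 : 2 * v^`().[1] = 0.
    by have := deriv_w_polyE p 1; rewrite -/w w0 deriv0 horner0 expr1n mulr1.
  by rewrite /dulac expr0n addr0 expr1n dv1 v1 mulr0 !mul0r addr0 ltxx.
have vw r : v.[r ^+ 2] = w.[r] by rewrite w_polyE.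
pose Z := [set r : R | 0 <= r /\ root w r].
have finZ : finite_set Z.
  by apply: sub_finite_set (finite_roots w0) => r [].
pose zs : seq R := fset_set Z.
have zsP r : (r \in zs) <-> Z r.
  by rewrite /zs in_fset_set// inE.
pose below (z : R * R) (r : R) : bool := r ^+ 2 < z.1 ^+ 2 + z.2 ^+ 2.
pose pt (g : set (R * R)) : R * R := xget (0, 0) g.
(* The root 0 is below every orbit, so the count is at least 1 and its predecessor is less than the
   number of roots. *)
pose idx g := (count (below (pt g)) zs).-1.
have zs0 : 0 \in zs.
  by apply/zsP; split => //; rewrite /root -vw /v /wv !hornerE expr0n mul0r.
have ptP g : limit_cycle P Q g -> exists x y T t,
    [/\ periodic_solution P Q x y T, g = orbit_of x y & pt g = (x t, y t)].
  move=> [[x [y [T [per gE]]]] _].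
  have : g (pt g) by apply: (@xgetPex _ (0, 0) g); exists (x 0, y 0); rewrite gE; exists 0.
  by rewrite {1}gE => -[t _ E]; exists x, y, T, t.
have cpos g : limit_cycle P Q g -> (0 < count (below (pt g)) zs)%N.
  move=> /ptP[x [y [T [t [per _ E]]]]]; rewrite -has_count; apply/hasP; exists 0 => //.
  by rewrite /below E expr0n /=; exact: (norm2_orbit_gt0 P00 Q00 t per).
(* The inequality between the radii of the chosen points nests the sets of roots below them, so
   equal counts give equal sets; the opposite inequality is symmetric. *)
have main g1 g2 : limit_cycle P Q g1 -> limit_cycle P Q g2 -> idx g1 = idx g2 ->
    (pt g1).1 ^+ 2 + (pt g1).2 ^+ 2 <= (pt g2).1 ^+ 2 + (pt g2).2 ^+ 2 -> g1 = g2.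
  move=> lc1 lc2 E le.
  have Ec : count (below (pt g1)) zs = count (below (pt g2)) zs.
    by have := cpos _ lc1; have := cpos _ lc2; move: E; rewrite /idx; lia.
  have sub r : below (pt g1) r -> below (pt g2) r by move=> h; exact: lt_le_trans le.
  have same := count_subset_eq sub Ec.
  have [x1 [y1 [T1 [t1 [per1 g1E pt1]]]]] := ptP _ lc1.
  have [x2 [y2 [T2 [t2 [per2 g2E pt2]]]]] := ptP _ lc2.
  rewrite g1E g2E; apply: (@same_roots_unique R P Q v s dulac_lt0 P00 Q00 _ _ _ _ _ _ per1 per2).
  move=> r r0 vr.
  have rZ : Num.sqrt r \in zs.
    apply/zsP; split; first exact: sqrtr_ge0.
    by rewrite /root -vw sqr_sqrtr// vr.
  have := same _ rZ; have := sub (Num.sqrt r); rewrite /below sqr_sqrtr// pt1 pt2 /= => s1 s2.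
  have cross := @orbit_between_roots R P Q v s dulac_lt0 P00 Q00.
  split=> h.
    apply: (cross _ _ _ _ t2 _ per2 vr); apply: s1; exact: (cross _ _ _ _ 0 _ per1 vr).
  apply: (cross _ _ _ _ t1 _ per1 vr); apply: s2; exact: (cross _ _ _ _ 0 _ per2 vr).
have inj : {in [set g | limit_cycle P Q g] &, injective idx}.
  move=> g1 g2 /set_mem lc1 /set_mem lc2 E.
  by case/orP: (le_total ((pt g1).1 ^+ 2 + (pt g1).2 ^+ 2) ((pt g2).1 ^+ 2 + (pt g2).2 ^+ 2));
    [exact: main|move=> le; apply/esym; exact: main].
rewrite -(card_le_eql (inj_card_eq inj)).
apply: subset_card_le => _ [g lc <-] /=.
have := cpos _ lc; have := count_size (below (pt g)) zs.
rewrite /idx /nb_nneg_roots -/Z; rewrite /zs; move: (count _ _) (size _) => k N; lia.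
Qed.
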